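(* Let $G=(V,E)$ be a connected graph with vertex colouring $\omega$ from colour-set $C$. Then $m(u,v)$ can be computed for every pair of vertices $u,v\in V$ in total time $O(|V|^3|E||C|^2)$.
   Context: Free-Flood-It: for a graph $G$ with vertex colouring $\omega$ from colour-set $C$, a move $(v,d)$ gives colour $d$ to every vertex of the monochromatic connected component containing $v$ in the current colouring; moves may be played at any vertex. $m(u,v,d)$ is the minimum number of moves needed so that $u$ and $v$ lie in a common monochromatic connected component of colour $d$, and $m(u,v)=\min_{d\in C} m(u,v,d)$ is the minimum number of moves needed to link $u$ and $v$ (put them in a common monochromatic component). *)

(* Defs.v *)
From mathcomp Require Import all_boot.

Set Implicit Arguments.
Unset Strict Implicit.
Unset Printing Implicit Defensive.

Section Graphs.
Variables (V : finType) (e : rel V).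

Definition simple_graph : Prop := symmetric e /\ irreflexive e.

Definition connected_graph : Prop := forall x y : V, connect e x y.

Definition edges : {set {set V}} := [set [set x; y] | x in V, y in V & e x y].

(* es lists every edge exactly once, in any order, with either orientation. *)
Definition edge_listing (es : seq (V * V)) : Prop :=
  perm_eq [seq [set p.1; p.2] | p <- es] (enum edges).

End Graphs.

Section FreeFloodIt.
Variables (V C : finType) (e : rel V).

Definition colouring := {ffun V -> C}.

Definition mono_component (w : colouring) (v : V) : {set V} :=
  [set x | connect [rel y z | e y z && (w y == w z)] v x].

Definition flood (w : colouring) (mv : V * C) : colouring :=
  [ffun x => if x \in mono_component w mv.1 then mv.2 else w x].

Definition play (w : colouring) (s : seq (V * C)) : colouring :=
  foldl flood w s.

Definition linked_in (w : colouring) (u v : V) (d : C) : bool :=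
  (v \in mono_component w u) && (w u == d).

Definition linkable (w : colouring) (u v : V) (d : C) : pred nat :=
  fun t => [exists s : t.-tuple (V * C), linked_in (play w s) u v d].

Lemma play_const (w : colouring) (d : C) (s : seq V) (x : V) :
  x \in s \/ w x = d -> play w [seq (v, d) | v <- s] x = d.
Proof.
elim: s w => [|v s IHs] w /=; first by case.
rewrite inE => xs; apply: IHs; rewrite ffunE /=.
case: ifP => [_|xNv]; first by right.
case: xs => [/orP[/eqP xv|xs]|wx]; [|by left|by right].
by rewrite xv inE connect0 in xNv.
Qed.

Lemma linkable_ex (e_conn : connected_graph e) (w : colouring) u v d :
  exists t, linkable w u v d t.
Proof.
exists #|V|; apply/existsP.
have sz : size [seq (x, d) | x <- enum V] == #|V| by rewrite size_map -cardE.
exists (Tuple sz).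
have wd x : play w [seq (x, d) | x <- enum V] x = d.
  by apply: play_const; left; rewrite mem_enum.
rewrite /linked_in /= wd eqxx andbT inE.
rewrite (@eq_connect _ _ e) // => x y /=.
by rewrite !wd eqxx andbT.
Qed.

Definition m3 (e_conn : connected_graph e) (w : colouring) (u v : V) (d : C)
  : nat := ex_minn (linkable_ex e_conn w u v d).

(* The minimum over all d : C; the default value m3 u v (w u) of the iterated
   minimum is one of the values over which the minimum is taken. *)
Definition m2 (e_conn : connected_graph e) (w : colouring) (u v : V) : nat :=
  \big[minn/m3 e_conn w u v (w u)]_(d : C) m3 e_conn w u v d.

End FreeFloodIt.

(* Random access machine with the uniform cost measure: a finite program acts
   on registers and on a memory, both indexed by nat and containing naturals.
   There is no multiplication, and subtraction is truncated. *)

Inductive instr : Type :=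
| IConst of nat & nat      (* IConst r c : R[r] <- c *)
| IAdd of nat & nat & nat  (* IAdd r s t : R[r] <- R[s] + R[t] *)
| ISub of nat & nat & nat  (* ISub r s t : R[r] <- R[s] - R[t] *)
| ILoad of nat & nat       (* ILoad r s  : R[r] <- M[R[s]] *)
| IStore of nat & nat      (* IStore r s : M[R[r]] <- R[s] *)
| IJz of nat & nat.        (* IJz r l    : if R[r] = 0 goto l *)

Definition program := seq instr.

Record config := Config { pc : nat; regs : nat -> nat; memory : nat -> nat }.

Definition upd (f : nat -> nat) (i x : nat) : nat -> nat :=
  fun j => if j == i then x else f j.

Definition exec (i : instr) (c : config) : config :=
  let: Config p R M := c in
  match i with
  | IConst r k => Config p.+1 (upd R r k) M
  | IAdd r s t => Config p.+1 (upd R r (R s + R t)) M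
  | ISub r s t => Config p.+1 (upd R r (R s - R t)) M
  | ILoad r s => Config p.+1 (upd R r (M (R s))) M
  | IStore r s => Config p.+1 R (upd M (R r) (R s))
  | IJz r l => Config (if R r == 0 then l else p.+1) R M
  end.

(* A configuration whose program counter is outside the program is halted. *)
Definition halted (P : program) (c : config) : bool := size P <= pc c.

Definition step (P : program) (c : config) : config :=
  if onth P (pc c) is Some i then exec i c else c.

Definition init (input : seq nat) : config :=
  Config 0 (fun _ => 0) (nth 0 input).

(* Since halted configurations are fixed by step, this says that P halts after
   at most t steps, with the output in the memory cells 0, 1, 2, ... *)
Definition computes_within (P : program) (input output : seq nat) (t : nat)
  : Prop :=
  let c := iter t (step P) (init input) in
  halted P c /\ forall i, i < size output -> memory c i = nth 0 output i.

(* Vertices and colours are represented by their ranks in enum V and enum C. *)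
Definition encode_instance (V C : finType) (es : seq (V * V))
    (w : colouring V C) : seq nat :=
  [:: #|V|; size es; #|C|]
  ++ [seq nat_of_ord (enum_rank (w v)) | v <- enum V]
  ++ flatten [seq [:: nat_of_ord (enum_rank p.1); nat_of_ord (enum_rank p.2)]
             | p <- es].

(* The |V| x |V| table of f, in row-major order. *)
Definition encode_table (V : finType) (f : V -> V -> nat) : seq nat :=
  [seq f u v | u <- enum V, v <- enum V].

(* Main.v *)
Require Import Defs.
From mathcomp Require Import all_boot.
From mathcomp Require Import zify.

(** The cost of a colour word is the least number of recolourings in a
derivation that turns the word into a constant word: a letter is free, a derived
word may be recoloured at cost 1, and two words derived to the same colour may
be concatenated. Then m(u,v,d) is the least cost, over all walks from u to v, of
deriving the colour word of the walk to d. The cost does not increase when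
letters are deleted, so walks may be shortcut through monochromatic components.
If the first move of an optimal play floods the component K, a walk for the
resulting colouring can be shortcut so as to visit K in a single block, and
undoing the move then costs one recolouring. Conversely, on a walk visiting each
component at most once, an innermost recolouring of the derivation acts on one
component, and flooding that component decreases the cost by one.

Derivations satisfy m(u,v,d) = min(1 + m(u,v,d'), m(u,x,d) + m(y,v,d)) over
colours d' and edges xy. A walk can be taken to be a path, which bounds the
depth of its derivation by 2|V|; hence 2|V| rounds of relaxing every entry
(u,v,d) along every edge and every colour compute the whole table. *)

Set Implicit Arguments.
Unset Strict Implicit.
Unset Printing Implicit Defensive.

(** * Derivations of colour words *)

(* [der s d k]: the word [s] can be turned into the colour [d] by [k]
   recolourings of already monochromatic factors. *)
Inductive der (C : Type) : seq C -> C -> nat -> Prop :=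
| der_leaf c : der [:: c] c 0
| der_recol s (a d : C) k : der s a k -> der s d k.+1
| der_split s t d k l : der s d k -> der t d l -> der (s ++ t) d (k + l).

Section Words.
Variable C : eqType.
Implicit Types (s t : seq C) (c d : C).

Lemma der_nonempty s d k : der s d k -> s != [::].
Proof. by elim=> // -[|x s1] t {}d {}k l. Qed.

Lemma der_const s d : s != [::] -> all (pred1 d) s -> der s d 0.
Proof.
elim: s => //= x [|y s] IH _ /andP[/eqP -> sd]; first exact: der_leaf.
by have := der_split (der_leaf d) (IH isT sd).
Qed.

Lemma der_each s d : s != [::] -> der s d (size s).
Proof.
elim: s => //= x [|y s] IH _; first exact/der_recol/der_leaf.
by have := der_split (der_recol d (der_leaf x)) (IH isT).
Qed.

Lemma der0_all s d : der s d 0 -> all (pred1 d) s.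
Proof.
move Ek: 0 => k D; elim: D Ek => //= [c|s1 t {}d {}k l _ IHs _ IHt].
  by rewrite eqxx.
move/esym/eqP; rewrite addn_eq0 all_cat => /andP[/eqP k0 /eqP l0].
by rewrite IHs ?IHt.
Qed.

Lemma eq_cat_cons (s t s1 s2 : seq C) c : s ++ t = s1 ++ c :: s2 ->
  (exists2 r, s = s1 ++ c :: r & s2 = r ++ t) \/
  (exists2 r, s1 = s ++ r & t = r ++ c :: s2).
Proof.
elim: s s1 => [|x s IH] [|y s1] /=.
- by move=> ->; right; exists [::].
- by move=> ->; right; exists (y :: s1).
- by case=> <- <-; left; exists s.
case=> -> /IH[[r -> ->]|[r -> ->]]; first by left; exists r.
by right; exists r.
Qed.

(** The leaf of the letter [c] is replaced by the whole derivation of [w], so the costs add. *)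
Lemma der_subst s1 c s2 d k w l :
  der (s1 ++ c :: s2) d k -> der w c l -> der (s1 ++ w ++ s2) d (k + l).
Proof.
move Es: (s1 ++ c :: s2) => s D Dw.
elim: D s1 s2 Es => {s d k} [c'|s a d k _ IH|s t d k k' Ds IHs Dt IHt] s1 s2 Es.
- by case: s1 Es => [|? [|? ?]] //= [<- ->]; rewrite cats0.
- by rewrite addSn; apply/der_recol/IH.
case: (eq_cat_cons (esym Es)) => [[r Es' ->]|[r -> Et]].
  have -> : s1 ++ w ++ r ++ t = (s1 ++ w ++ r) ++ t by rewrite -!catA.
  rewrite addnAC; exact: der_split (IHs _ _ (esym Es')) Dt.
by rewrite -addnA -catA; apply: der_split => //; apply: IHt.
Qed.

Lemma subseq_cat_split (s' s t : seq C) : subseq s' (s ++ t) ->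
  exists s1 s2, [/\ s' = s1 ++ s2, subseq s1 s & subseq s2 t].
Proof.
elim: s s' => [|x s IH] s'; first by exists [::], s'; rewrite sub0seq.
case: s' => [|y s'] /=; first by exists [::], [::]; rewrite !sub0seq.
case: eqP => [->|_] /IH[s1 [s2 [-> ss1 ss2]]].
  by exists (x :: s1), s2; rewrite /= eqxx.
by exists s1, s2; split=> //; apply: subseq_trans ss1 (subseq_cons _ _).
Qed.

(** The leaves of deleted letters are pruned. A concatenation with one side emptied collapses to its
    other side, so no recolouring is ever added. *)
Lemma der_subseq s d k s' : der s d k -> subseq s' s -> s' != [::] ->
  exists2 k', k' <= k & der s' d k'.
Proof.
move=> D; elim: D s' => {s d k} [c|s a d k _ IH|s t d k l _ IHs _ IHt] s'.
- case: s' => // y [|z s'] ss _; last by have := size_subseq ss.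
  by move: ss; rewrite sub1seq inE => /eqP ->; exists 0 => //; apply: der_leaf.
- move=> /IH H /H[k' lek D]; by exists k'.+1 => //; apply: der_recol D.
case/subseq_cat_split=> [[|x s1] [[|y s2] [-> ss1 ss2]]] // _.
- by case: (IHt _ ss2) => // l' le_l D; exists l' => //=; lia.
- by case: (IHs _ ss1) => // k' le_k D; exists k'; rewrite ?cats0 //; lia.
case: (IHt _ ss2) => // l' le_l Dl; case: (IHs _ ss1) => // k' le_k Dk.
by exists (k' + l'); [lia|apply: der_split].
Qed.

(* In a word without equal neighbours, an innermost recolouring acts on a
   single letter, so it can be performed first. *)
Lemma der_first s d k : der s d k -> sorted [rel a b | a != b] s -> 0 < k ->
  exists s1 a s2 c k', [/\ s = s1 ++ a :: s2, der (s1 ++ c :: s2) d k' & k' < k].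
Proof.
elim=> {s d k} // [s a d [|k] D IH|s t d k l Ds IHs Dt IHt] Hs.
- have := der0_all D; case: s D Hs {IH} => [/der_nonempty //|x [|y s]] /= _.
    by move=> _ _ _; exists [::], x, [::], d, 0; split=> //; apply: der_leaf.
  by case/andP=> /= xy _ /and3P[/eqP Ex /eqP Ey _]; rewrite Ex Ey eqxx in xy.
- case: (IH Hs isT) => s1 [b [s2 [c [k' [-> D' lt_k]]]]] _.
  by exists s1, b, s2, c, k'.+1; split=> //; apply: der_recol D'.
have [Hss Hst] := cat_sorted2 Hs; move=> kl_gt0.
have [k0|k_gt0] := posnP k.
  have l_gt0 : 0 < l by lia.
  case: (IHt Hst l_gt0) => s1 [b [s2 [c [l' [Et D' lt_l]]]]].
  exists (s ++ s1), b, s2, c, (k + l'); rewrite Et -!catA; split=> //.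
    exact: der_split.
  by rewrite ltn_add2l.
case: (IHs Hss k_gt0) => s1 [b [s2 [c [k' [Es D' lt_k]]]]].
exists s1, b, (s2 ++ t), c, (k' + l); rewrite Es -catA; split=> //.
  by have := der_split D' Dt; rewrite -catA.
by rewrite ltn_add2r.
Qed.

End Words.

(** Loops are cut out of the walk. The subsequence clause lets [der_subseq] carry the cost over to
    the shortened walk. *)
Lemma shorten_subseq (T : eqType) (e : rel T) x p : path e x p ->
  exists p', [/\ path e x p', uniq (x :: p'), last x p' = last x p & subseq p' p].
Proof.
elim: p x => [|y p IH] x /=; first by exists [::].
case/andP=> exy /IH[p' [Pp' Up' <- ss]].
have ss' : subseq (y :: p') (y :: p) by rewrite /= eqxx.
have [xin|xnin] := boolP (x \in y :: p'); last first.
  by exists (y :: p'); split; rewrite //= ?exy // xnin.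
have [i [p2 E]] : exists q1 q2, y :: p' = q1 ++ x :: q2.
  by case/splitPr: xin => q1 q2; exists q1, q2.
exists p2; have El : last y p' = last x p2.
  by rewrite -(last_cons x) E last_cat.
have Pp : path e x (y :: p') by rewrite /= exy.
rewrite E cat_path /= in Pp; case/and3P: Pp => _ _ P2.
have : uniq (i ++ x :: p2) by rewrite -E.
rewrite cat_uniq => /and3P[_ _ U2]; split=> //.
apply: subseq_trans ss'; rewrite E.
by apply: subseq_trans (suffix_subseq _ _); apply: subseq_cons.
Qed.

(** Applied with [P] as membership in the flooded component: everything between the first and the
    last visit can then be replaced by a path inside it. *)
Lemma first_last (T : Type) (P : pred T) s : has P s ->
  exists s1 a m s3, [/\ s = s1 ++ a :: m ++ s3, P a, P (last a m),
                        ~~ has P s1 & ~~ has P s3].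
Proof.
elim: s => //= x s IH; case: (boolP (has P s)) => [/IH|nPs].
  case=> s1 [a [m [s3 [-> Pa Pl n1 n3]]]] _; case Px: (P x).
    by exists [::], x, (s1 ++ a :: m), s3; rewrite -catA last_cat; split.
  by exists (x :: s1), a, m, s3; split; rewrite //= Px.
by rewrite orbF => Px; exists [::], x, [::], s.
Qed.

(** * Linking two vertices *)

Section Linking.
Variables (V C : finType) (e : rel V).
Hypothesis e_sym : symmetric e.
Implicit Types (w : colouring V C) (u v : V) (d : C).

Local Notation mono w := ([rel y z | e y z && (w y == w z)]).

Lemma mono_connect_sym w : connect_sym (mono w).
Proof.
by apply: sym_connect_sym => x y; rewrite /= e_sym eq_sym.
Qed.

Lemma mono_path_colour w x p : path (mono w) x p ->
  path e x p /\ all (pred1 (w x)) (map w p).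
Proof.
elim: p x => //= y p IH x /andP[/andP[exy /eqP wxy] /IH[Pp ap]].
by rewrite exy Pp wxy eqxx.
Qed.

Lemma connect_colour w x y : connect (mono w) x y -> w x = w y.
Proof.
case/connectP=> p /mono_path_colour[_]; elim: p x => [x _ -> //|z p IH x].
by case/andP=> /= /eqP <- H /IH; apply.
Qed.

Lemma flood_in w y c x : connect (mono w) y x -> flood e w (y, c) x = c.
Proof. by move=> yx; rewrite ffunE inE yx. Qed.

Lemma flood_notin w y c x : ~~ connect (mono w) y x -> flood e w (y, c) x = w x.
Proof. by move=> yx; rewrite ffunE inE (negPf yx). Qed.

(** A monochromatic edge lies either wholly inside or wholly outside the flooded component, so its
    ends keep a common colour. *)
Lemma connect_flood w mv : subrel (connect (mono w)) (connect (mono (flood e w mv))).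
Proof.
case: mv => y c; apply: connect_sub => a b /= /andP[eab wab]; apply: connect1.
have ab : connect (mono w) a b by apply: connect1; rewrite /= eab.
rewrite /= eab /=; have [ya|ya] := boolP (connect (mono w) y a).
  by rewrite !flood_in //; apply: connect_trans ab.
rewrite !flood_notin //; apply: contra ya => yb; apply: connect_trans yb _.
by rewrite mono_connect_sym.
Qed.

Lemma linkableS w u v d mv t :
  linkable e (flood e w mv) u v d t -> linkable e w u v d t.+1.
Proof. by case/existsP=> s H; apply/existsP; exists [tuple of mv :: s]. Qed.

Lemma linkable_walk w u v d t : linkable e w u v d t ->
  exists p k, [/\ path e u p, last u p = v, k <= t & der (map w (u :: p)) d k].
Proof.
elim: t w => [|t IH] w /existsP[s].
  rewrite tuple0 /linked_in inE /= => /andP[/connectP[p Pp ->] /eqP wu].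
  have [Pe ap] := mono_path_colour Pp; exists p, 0; split=> //.
  by apply: der_const; rewrite //= -wu eqxx.
case/tupleP: s => -[y c] s Hs.
have {}/IH : linkable e (flood e w (y, c)) u v d t by apply/existsP; exists s.
set w1 := flood e w (y, c); case=> p [k [Pp lp lek D]].
have nK (q : seq V) : ~~ has (connect (mono w) y) q -> map w1 q = map w q.
  move=> nq; apply/eq_in_map => x xq; apply: flood_notin.
  by apply: contra nq => yx; apply/hasP; exists x.
(* A walk that avoids the flooded component has the same colour word before and after the move. *)
case: (boolP (has (connect (mono w) y) (u :: p))) => [|/nK E]; last first.
  by exists p, k; rewrite -E; split=> //; apply: leqW.
case/first_last=> q1 [a [m [q3 [Eq ya yb /nK n1 /nK n3]]]].
have ab : connect (mono w) a (last a m).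
  by apply: connect_trans yb; rewrite mono_connect_sym.
case/connectP: ab => m' /mono_path_colour[Pm' am'] Em.
(* The block from the first to the last visit is reduced to the single letter [c] of its first
   vertex. *)
have [k' lek' D'] : exists2 k', k' <= k & der (map w q1 ++ c :: map w q3) d k'.
  apply: (der_subseq D); last by case: (map w q1).
  rewrite Eq -n1 -n3 -(flood_in c ya) -/w1 -map_cons -map_cat map_subseq //.
  by rewrite cat_subseq //= eqxx suffix_subseq.
(* The path [m'] inside the component is constant under [w], so one recolouring pays for the undone
   move. *)
have Dm : der (map w (a :: m')) c 1.
  by apply/(@der_recol _ _ (w a))/der_const; rewrite //= eqxx.
have := der_subst D' Dm; rewrite -!map_cat => D2.
have Hq : exists q, [/\ u :: q = q1 ++ (a :: m') ++ q3, path e u q & last u q = v].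
  case: q1 Eq {n1 D' D2} => [|x q1] [Ex Ep]; rewrite Ex.
    exists (m' ++ q3); split=> //; move: Pp lp; rewrite Ex Ep !cat_path !last_cat.
      by rewrite Em Pm' => /andP[].
    by rewrite Em.
  exists (q1 ++ (a :: m') ++ q3); split=> //; move: Pp lp; rewrite Ex Ep.
    rewrite !(cat_path, last_cat) /= !(cat_path, last_cat) Em Pm'.
    by case/and4P=> -> -> _ ->.
  by rewrite !(cat_path, last_cat) /= !(cat_path, last_cat) Em.
case: Hq => q [Eq2 Pq lq]; exists q, (k' + 1); split=> //; first by lia.
by rewrite Eq2.
Qed.

(** Adjacency of monochromatic components lifted to vertices, so that a chain of components may be
    given by any representatives. *)
Let step w : rel V :=
  fun x y => [exists x', exists y',
    [&& connect (mono w) x x', e x' y' & connect (mono w) y' y]].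

Lemma stepP w x y : reflect
  (exists x' y', [/\ connect (mono w) x x', e x' y' & connect (mono w) y' y])
  (step w x y).
Proof.
apply: (iffP existsP) => [[x' /existsP[y' /and3P[xx' exy yy']]]|].
  by exists x', y'.
case=> x' [y' [xx' exy yy']]; exists x'; apply/existsP; exists y'.
by rewrite xx' exy yy'.
Qed.

Lemma step_same_colour w x y : step w x y -> w x = w y -> connect (mono w) x y.
Proof.
case/stepP=> x' [y' [xx' exy yy']] wxy.
apply: (connect_trans xx'); apply: connect_trans (connect1 _) (yy').
by rewrite /= exy -(connect_colour xx') wxy -(connect_colour yy') eqxx.
Qed.

Lemma step_path_linked w x p d : path (step w) x p ->
  all (pred1 d) (map w (x :: p)) -> connect (mono w) x (last x p).
Proof.
elim: p x => //= y p IH x /andP[xy Pp] /and3P[/eqP wx wy ap].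
apply: connect_trans (step_same_colour xy _) (IH y Pp _); last by rewrite /= wy.
by rewrite wx (eqP wy).
Qed.

(* Along a chain of pairwise distinct monochromatic components, flooding one
   component changes exactly one letter of the colour word. *)
Lemma chain_linkable k w u v d x p : path (step w) x p ->
    connect (mono w) u x -> connect (mono w) (last x p) v ->
    der (map w (x :: p)) d k ->
  exists2 t, t <= k & linkable e w u v d t.
Proof.
elim/ltn_ind: k w x p => k IH w x p Pp ux pv D.
(* Replacing each vertex by the root of its component and then cutting loops makes the chain visit
   every component at most once. *)
pose r := root (mono w); have csym := mono_connect_sym w.
have wr z : w (r z) = w z by rewrite -(connect_colour (connect_root _ z)).
have rr z : r (r z) = r z by apply/(rootP csym); rewrite csym connect_root.
have step_r : {homo r : a b / step w a b}.
  move=> a b /stepP[a' [b' [aa' eab bb']]]; apply/stepP; exists a', b'; split=> //.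
    by apply: connect_trans aa'; rewrite csym connect_root.
  exact: connect_trans bb' (connect_root _ _).
case: (shorten_subseq (homo_path step_r Pp)) => p' [Pp' Up' lp' ss].
have rootp z : z \in r x :: p' -> r z = z.
  rewrite inE => /orP[/eqP -> //|/(mem_subseq ss)/mapP[z' _ ->]]; exact: rr.
have ux' : connect (mono w) u (r x) by apply: connect_trans ux (connect_root _ _).
have pv' : connect (mono w) (last (r x) p') v.
  by rewrite lp' last_map; apply: connect_trans pv; rewrite csym connect_root.
have [k' lek D'] : exists2 k', k' <= k & der (map w (r x :: p')) d k'.
  apply: (der_subseq D) => //.
  have -> : map w (x :: p) = map w (map r (x :: p)).
    by rewrite -map_comp; apply: eq_map => z /=; rewrite wr.
  by apply: map_subseq; rewrite /= eqxx.
have [k0|k_gt0] := posnP k'.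
  rewrite k0 in D'; have ad := der0_all D'; exists 0 => //.
  have uv := connect_trans ux' (connect_trans (step_path_linked Pp' ad) pv').
  apply/existsP; exists [tuple]; rewrite /linked_in inE uv /=.
  by rewrite (connect_colour ux'); case/andP: ad.
(* Consecutive components of equal colour would be connected and share a root, contradicting
   uniqueness. *)
have adj : sorted [rel a b | a != b] (map w (r x :: p')).
  elim: (p') (r x) Pp' Up' rootp => //= b q IHq a /andP[ab Pq].
  move=> /andP[anbq Uq] rq; rewrite IHq // ?andbT.
    apply: contraNneq anbq => /(step_same_colour ab)/(rootP csym).
    by rewrite -/r !rq ?inE ?eqxx ?orbT // => ->; rewrite eqxx.
  by move=> z zq; apply: rq; rewrite inE zq orbT.
case: (der_first D' adj k_gt0) => s1 [a [s2 [c [k2 [Es D2 ltk]]]]].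
have [q1 [y [q2 [Eq E1 E2]]]] : exists q1 y q2,
  [/\ r x :: p' = q1 ++ y :: q2, map w q1 = s1 & map w q2 = s2].
  have szE := congr1 size Es; rewrite size_map size_cat /= in szE.
  move: (congr1 (take (size s1)) Es) (congr1 (drop (size s1).+1) Es).
  rewrite -map_take -map_drop take_size_cat // -cat_rcons drop_size_cat ?size_rcons //.
  move=> T1 T2; exists (take (size s1) (r x :: p')), (nth x (r x :: p') (size s1)).
  exists (drop (size s1).+1 (r x :: p')); split=> //.
  by rewrite -drop_nth ?cat_take_drop //=; lia.
pose w1 := flood e w (y, c).
(* The other vertices of the chain are distinct roots, so they lie outside the flooded component. *)
have w1q z : z \in q1 ++ q2 -> w1 z = w z.
  move=> zq; apply: flood_notin; apply/negP => /(rootP csym); rewrite -/r.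
  have mem t : t \in y :: q1 ++ q2 -> r t = t.
    move=> ty; apply: rootp; rewrite Eq mem_cat inE.
    by move: ty; rewrite inE mem_cat => /or3P[]->; rewrite ?orbT.
  rewrite !mem ?inE ?eqxx ?zq ?orbT // => yz.
  by move: Up'; rewrite Eq -cat1s uniq_catCA /= yz zq.
have w1E : map w1 (r x :: p') = s1 ++ c :: s2.
  rewrite Eq map_cat /= (flood_in _ (connect0 _ _)) -E1 -E2.
  by congr (_ ++ _ :: _); apply/eq_in_map => z zq; apply: w1q; rewrite mem_cat zq ?orbT.
(* Connections inside components survive the flooding, so the same vertices still form a chain for
   [w1]. *)
have sub := @connect_flood w (y, c).
have Pw1 : path (step w1) (r x) p'.
  apply: sub_path Pp' => a' b' /stepP[a1 [b1 [aa eab bb]]].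
  by apply/stepP; exists a1, b1; split; rewrite // sub.
rewrite -w1E in D2.
case: (IH k2 _ w1 (r x) p' Pw1 (sub _ _ ux') (sub _ _ pv') D2); first by lia.
by move=> t let_ /linkableS lk; exists t.+1 => //; lia.
Qed.

Lemma walk_linkable w u p d k : path e u p -> der (map w (u :: p)) d k ->
  exists2 t, t <= k & linkable e w u (last u p) d t.
Proof.
move=> Pp; apply: chain_linkable => //.
by apply: sub_path Pp => a b ab; apply/stepP; exists a, b.
Qed.

(* Derivations along walks; the first index bounds the depth, that is, the
   number of rounds after which the algorithm has found the derivation. *)
Inductive bder w : nat -> V -> V -> C -> nat -> Prop :=
| bder_leaf r u : bder w r u u (w u) 0
| bder_recol r u v a d k : bder w r u v a k -> bder w r.+1 u v d k.+1
| bder_split r u x y v d k l : bder w r u x d k -> e x y -> bder w r y v d l ->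
    bder w r.+1 u v d (k + l).

Lemma bder_le w r r' u v d k : bder w r u v d k -> r <= r' -> bder w r' u v d k.
Proof.
move=> B; elim: B r' => {r u v d k} 
  [r u|r u v a d k _ IH|r u x y v d k l _ IHk exy _ IHl] [|r'] //.
- by move=> _; apply: bder_leaf.
- by move=> _; apply: bder_leaf.
- by move=> /IH; apply: bder_recol.
by move=> le_r; apply: bder_split (IHk _ le_r) exy (IHl _ le_r).
Qed.

(* Consecutive recolourings collapse, so between two recolourings of a shortest
   derivation the walk is split. *)
Lemma walk_bder w u p d k : path e u p -> der (map w (u :: p)) d k ->
  exists a k', bder w (size p).*2 u (last u p) a k' /\ k' + (a != d) <= k.
Proof.
move Es: (map w (u :: p)) => s Pp D.
elim: D u p Es Pp => {s d k} [c|s a d k _ IH|s t d k l Ds IHs Dt IHt] u p Es Pp.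
- case: p Es Pp => //= -[<-] _; exists (w u), 0; rewrite eqxx; split=> //.
  exact: bder_leaf.
(* The pending recolouring, counted by [a != d], is kept outside the bounded derivation; only its
   target changes. *)
- case: (IH _ _ Es Pp) => a' [k' [B le_k]]; exists a', k'; split=> //.
  by case: (a' != d); lia.
(* Before two parts are joined their pending recolourings have to be carried out, at one extra level
   of depth. *)
have to_d r x y a j j' : bder w r x y a j -> j + (a != d) <= j' ->
  exists2 j2, j2 <= j' & bder w r.+1 x y d j2.
  case: (eqVneq a d) => [->|_] B le_j /=.
    by exists j; [move: le_j; rewrite addn0|apply: bder_le B _].
  by exists j.+1; [move: le_j; rewrite addn1|apply: bder_recol B].
move: (der_nonempty Ds) (der_nonempty Dt) => {Ds Dt}.
case: s t Es IHs IHt => [|c s] [|c' t] //= [wu Ep] IHs IHt _ _.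
have szp := congr1 size Ep; rewrite size_map size_cat /= in szp.
pose p1 := take (size s) p; pose p2 := drop (size s).+1 p.
pose y := nth u p (size s).
have Epy : p = p1 ++ y :: p2 by rewrite -drop_nth ?cat_take_drop //; lia.
have E1 : map w p1 = s by rewrite map_take Ep take_size_cat.
have E2 : map w (y :: p2) = c' :: t.
  by rewrite -drop_nth ?map_drop ?Ep ?drop_size_cat //; lia.
move: Pp; rewrite Epy cat_path /= => /and3P[P1 ey P2].
case: (IHs u p1 _ P1) => [|a1 [k1 [B1 l1]]].
  by rewrite /= wu E1.
case: (IHt y p2 E2 P2) => a2 [k2 [B2 l2]].
have [k1' le1 {}B1] := to_d _ _ _ _ _ _ B1 l1.
have [k2' le2 {}B2] := to_d _ _ _ _ _ _ B2 l2.
exists d, (k1' + k2'); rewrite eqxx; split; last by lia.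
(* The edge between the parts adds one to the length, which pays for two levels: one to recolour a
   part and one to join. *)
rewrite last_cat size_cat /= addnS doubleS.
have le_1 : (size p1).*2.+1 <= (size p1 + size p2).*2.+1 by lia.
have le_2 : (size p2).*2.+1 <= (size p1 + size p2).*2.+1 by lia.
exact: bder_split (bder_le B1 le_1) ey (bder_le B2 le_2).
Qed.

(** * Inequalities and bounds for m(u,v,d) *)

Hypothesis e_conn : connected_graph e.
Local Notation m3 := (m3 e_conn).
Local Notation m2 := (m2 e_conn).

Lemma m3_walk w u v d : exists p k,
  [/\ path e u p, last u p = v, k <= m3 w u v d & der (map w (u :: p)) d k].
Proof. by apply: linkable_walk; rewrite /m3; case: ex_minnP. Qed.

Lemma m3_le_der w u p d k : path e u p -> der (map w (u :: p)) d k ->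
  m3 w u (last u p) d <= k.
Proof.
move=> Pp /(walk_linkable Pp)[t le_t lk]; apply: leq_trans le_t.
by rewrite /m3; case: ex_minnP => m _; apply.
Qed.

Lemma m3_refl w u : m3 w u u (w u) = 0.
Proof.
by apply/eqP; rewrite -leqn0; apply: (@m3_le_der w u [::]) => //; apply: der_leaf.
Qed.

Lemma m3_recol w u v a d : m3 w u v d <= (m3 w u v a).+1.
Proof.
case: (m3_walk w u v a) => p [k [Pp <- le_k D]].
by apply: leq_trans (m3_le_der Pp (der_recol d D)) _.
Qed.

Lemma m3_split w u x y v d : e x y -> m3 w u v d <= m3 w u x d + m3 w y v d.
Proof.
move=> exy; case: (m3_walk w u x d) => p [k [Pp lp le_k D]].
case: (m3_walk w y v d) => q [l [Pq <- le_l D']].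
have Ppq : path e u (p ++ y :: q) by rewrite cat_path lp /= Pp exy.
have Dpq : der (map w (u :: p ++ y :: q)) d (k + l).
  by rewrite -cat_cons map_cat; apply: der_split.
have := m3_le_der Ppq Dpq; rewrite last_cat /= => H; apply: leq_trans H _.
exact: leq_add.
Qed.

(** Every vertex of a path from [u] to [v] is recoloured once. This makes |V| a sound initial table
    entry. *)
Lemma m3_le_card w u v d : m3 w u v d <= #|V|.
Proof.
case/connectP: (e_conn u v) => p /shorten_subseq[p' [Pp Up <- _]] ->.
have D : der (map w (u :: p')) d (size (map w (u :: p'))) by apply: der_each.
apply: leq_trans (m3_le_der Pp D) _.
by rewrite size_map -(card_uniqP Up) max_card.
Qed.

Lemma m3_bder w u v d : exists2 k, k <= m3 w u v d & bder w (#|V|).*2 u v d k.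
Proof.
case: (m3_walk w u v d) => p [k [Pp lp le_k D]].
case: (shorten_subseq Pp) => q [Pq Uq lq ss].
case: (der_subseq D (_ : subseq (map w (u :: q)) _)) => // [|k' le_k' D'].
  by apply: map_subseq; rewrite /= eqxx.
have szq : (size q) < #|V| by rewrite -(card_uniqP Uq : _ = (size q).+1) max_card.
case: (walk_bder Pq D') => a [j [B le_j]]; rewrite lq lp in B.
have le_j' : j + (a != d) <= m3 w u v d.
  exact: leq_trans le_j (leq_trans le_k' le_k).
(* The path has fewer than |V| edges, so a last recolouring to [d] still fits into depth 2|V|. *)
case: (eqVneq a d) le_j' B => [->|_] /=; rewrite ?addn0 ?addn1 => le_m B.
  by exists j => //; apply: bder_le B _; rewrite leq_double ltnW.
exists j.+1 => //.
by apply: bder_le (bder_recol d B) _; rewrite ltn_double.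
Qed.

Lemma m2_le w u v d : m2 w u v <= m3 w u v d.
Proof.
rewrite /m2; have : d \in index_enum C by rewrite mem_index_enum.
elim: (index_enum C) => // a s IH; rewrite inE big_cons => /orP[/eqP <-|/IH].
  exact: geq_minl.
exact/leq_trans/geq_minr.
Qed.

Lemma m2_attained w u v : exists d, m2 w u v = m3 w u v d.
Proof.
rewrite /m2; elim/big_ind: _ => [|a b [da ->] [db ->]|d _]; first by exists (w u).
- by case: (leqP (m3 w u v da) (m3 w u v db)); [exists da|exists db].
- by exists d.
Qed.

End Linking.

(** * Structured programs for the random access machine *)

Definition state : Type := ((nat -> nat) * (nat -> nat))%type.

Inductive cmd : Type :=
| Do of seq instr
| Seq of cmd & cmd
| Loop of nat & cmd.

Infix ";;" := Seq (at level 61, right associativity).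

Definition run1 (s : state) (i : instr) : state :=
  let c := exec i (Config 0 s.1 s.2) in (regs c, memory c).

(* Register 0 is scratch space: it turns [IJz] into an unconditional jump. *)
Definition tick (r : nat) : seq instr :=
  [:: IConst 0 1; ISub r r 0; IConst 0 0].

Definition tock (r : nat) (s : state) : state := foldl run1 s (tick r).

Fixpoint den (c : cmd) (s : state) : state :=
  match c with
  | Do l => foldl run1 s l
  | Seq a b => den b (den a s)
  | Loop r a => iter (s.1 r) (fun t => tock r (den a t)) s
  end.

(** Beyond its body, a pass of a loop costs 5: the test, the three instructions of [tick] and the
    jump back. The failing test at the end costs 1 more. *)
Fixpoint cost (c : cmd) (s : state) : nat :=
  match c with
  | Do l => size l
  | Seq a b => cost a s + cost b (den a s)
  | Loop r a =>
      (\sum_(i < s.1 r) (cost a (iter i (fun t => tock r (den a t)) s) + 5)).+1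
  end.

Fixpoint csize (c : cmd) : nat :=
  match c with
  | Do l => size l
  | Seq a b => csize a + csize b
  | Loop r a => csize a + 5
  end.

(** Jump targets are absolute, hence the start address [p]. The closing [IJz 0 p] always jumps
    because [tick] leaves 0 in register 0. *)
Fixpoint compile (p : nat) (c : cmd) : program :=
  match c with
  | Do l => l
  | Seq a b => compile p a ++ compile (p + csize a) b
  | Loop r a =>
      IJz r (p + csize a + 5) :: compile p.+1 a ++ tick r ++ [:: IJz 0 p]
  end.

Definition dest (i : instr) : seq nat :=
  match i with
  | IConst r _ | IAdd r _ _ | ISub r _ _ | ILoad r _ => [:: r]
  | IStore _ _ | IJz _ _ => [::]
  end.

Fixpoint writes (c : cmd) : seq nat :=
  match c with
  | Do l => flatten (map dest l)
  | Seq a b => writes a ++ writes b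
  | Loop r a => 0 :: r :: writes a
  end.

Definition jump (i : instr) : bool := if i is IJz _ _ then true else false.

(* The body of a loop may not write to the loop counter, so that the number of
   passes is the value of the counter on entry, as in [den]. *)
Fixpoint wf (c : cmd) : bool :=
  match c with
  | Do l => ~~ has jump l
  | Seq a b => wf a && wf b
  | Loop r a => [&& wf a, r != 0 & r \notin writes a]
  end.

Lemma size_compile p c : size (compile p c) = csize c.
Proof.
elim: c p => //= [a IHa b IHb|r a IHa] p; rewrite ?size_cat ?IHa ?IHb //=.
by rewrite -addnS.
Qed.

Lemma frame c s k : k \notin writes c -> (den c s).1 k = s.1 k.
Proof.
elim: c s => [l|a IHa b IHb|r a IHa] s /=.
- elim: l s => //= i l IH s; rewrite mem_cat negb_or => /andP[ki /IH ->].
  case: i ki => [r c|r a b|r a b|r a|a b|a b] //=;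
  by rewrite inE => /negPf kr; rewrite /upd kr.
- by rewrite mem_cat negb_or => /andP[ka kb]; rewrite IHb ?IHa.
rewrite !inE !negb_or => /and3P[k0 kr ka].
by elim: (s.1 r) => //= n IHn; rewrite /upd (negPf k0) (negPf kr) IHa.
Qed.

(** * Correctness and exact running time of compiled code *)

Section Simulation.
Variable P : program.

Let runs m p (s : state) q (t : state) : Prop :=
  iter m (step P) (Config p s.1 s.2) = Config q t.1 t.2.

Lemma runs_trans m1 m2 p q r s t u :
  runs m1 p s q t -> runs m2 q t r u -> runs (m1 + m2) p s r u.
Proof. by rewrite /runs addnC iterD => -> ->. Qed.

Lemma step_at l1 i l2 R M : P = l1 ++ i :: l2 ->
  step P (Config (size l1) R M) = exec i (Config (size l1) R M).
Proof.
by move=> ->; rewrite /step /=; have -> : onth (l1 ++ i :: l2) (size l1) = Some i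
  by elim: l1.
Qed.

Lemma runs_block l l1 l2 s : ~~ has jump l -> P = l1 ++ l ++ l2 ->
  runs (size l) (size l1) s (size l1 + size l) (foldl run1 s l).
Proof.
elim: l l1 s => [|i l IH] l1 s /=; first by rewrite addn0.
rewrite negb_or => /andP[ni nl] EP.
have := IH (rcons l1 i) (run1 s i) nl; rewrite cat_rcons size_rcons addSnnS.
move/(_ EP); rewrite /runs iterSr (step_at _ _ EP) => <-; congr iter.
by case: i ni {EP}.
Qed.

(** Induction on the command, with arbitrary code around it so that the hypothesis applies to
    subcommands at their own addresses. *)
Lemma compile_correct c l1 l2 s : wf c ->
    P = l1 ++ compile (size l1) c ++ l2 ->
  runs (cost c s) (size l1) s (size l1 + csize c) (den c s).
Proof.
elim: c l1 l2 s => [l|a IHa b IHb|r a IHa] l1 l2 s /=.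
- exact: runs_block.
- case/andP=> wa wb; rewrite -catA => EP.
  apply: runs_trans (IHa _ _ _ wa EP) _.
  have := IHb (l1 ++ compile (size l1) a) l2 (den a s) wb.
  by rewrite size_cat size_compile addnA -catA => /(_ EP).
case/and3P=> wa r0 rnw; rewrite -!catA /= => EP.
pose f t := tock r (den a t); rewrite -/f.
have test t : runs 1 (size l1) t
    (if t.1 r == 0 then size l1 + csize a + 5 else (size l1).+1) t.
  by rewrite /runs /= (step_at _ _ EP).
have turn t : t.1 r != 0 -> runs (cost a t + 5) (size l1) t (size l1) (f t).
  move=> tr; rewrite (_ : cost a t + 5 = 1 + (cost a t + (3 + 1))); last by lia.
  have T1 := test t; rewrite (negPf tr) in T1; apply: runs_trans T1 _.
  pose l0 := rcons l1 (IJz r (size l1 + csize a + 5)).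
  have sz0 : size l0 = (size l1).+1 by rewrite size_rcons.
  have EP2 : P = l0 ++ compile (size l0) a ++ (tick r ++ IJz 0 (size l1) :: l2).
    by rewrite EP sz0 cat_rcons.
  rewrite -sz0; apply: runs_trans (IHa _ _ t wa EP2) _; rewrite catA in EP2.
  have T3 := @runs_block (tick r) _ _ (den a t) isT EP2.
  rewrite size_cat size_compile in T3; apply: runs_trans T3 _; rewrite catA in EP2.
  have sz3 : size ((l0 ++ compile (size l0) a) ++ tick r)
    = size l0 + csize a + size (tick r) by rewrite !size_cat size_compile.
  by rewrite /runs -sz3 /= (step_at _ _ EP2).
(* The body does not write the counter, so a pass changes it only by the decrement in [tick]. *)
have fr t : (f t).1 r = (t.1 r).-1.
  by rewrite /f /tock /= /upd eqxx (negPf r0) /= frame // subn1.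
have : forall n, n <= s.1 r ->
  runs (\sum_(i < n) (cost a (iter i f s) + 5)) (size l1) s (size l1) (iter n f s)
  /\ (iter n f s).1 r = s.1 r - n.
  elim=> [|n IHn] len; first by rewrite big_ord0 subn0.
  have [T En] := IHn (ltnW len); rewrite big_ord_recr iterS; split.
    by apply: runs_trans T (turn _ _); rewrite En; lia.
  by rewrite fr En; lia.
case/(_ _ (leqnn _)) => T En; rewrite -addn1; apply: runs_trans T _.
by have := test (iter (s.1 r) f s); rewrite En subnn /= addnA.
Qed.

End Simulation.

Lemma compile_computes c input output t : wf c ->
    cost c (fun=> 0, nth 0 input) <= t ->
    (forall i, i < size output ->
       (den c (fun=> 0, nth 0 input)).2 i = nth 0 output i) ->
  computes_within (compile 0 c) input output t.
Proof.
set s := (_, _) => wc le_t out; rewrite /computes_within /=.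
have := @compile_correct (compile 0 c) c [::] [::] s wc.
rewrite cats0 => /(_ erefl) /= E.
(* Steps left over after halting change nothing, so any bound above the exact cost serves. *)
have halt n x : iter n (step (compile 0 c)) (Config (csize c) x.1 x.2)
  = Config (csize c) x.1 x.2.
  elim: n => //= n ->; rewrite /step /= -(size_compile 0 c).
  by rewrite onth_default.
have -> : iter t (step (compile 0 c)) (init input)
  = Config (csize c) (den c s).1 (den c s).2.
  by rewrite -(subnK le_t) iterD E halt.
by split; rewrite /halted /= ?size_compile.
Qed.

(** * Hoare triples with a bound on the running time *)

Definition triple (s : state) (c : cmd) (b : nat) (Q : state -> Prop) : Prop :=
  Q (den c s) /\ cost c s <= b.

(** For a concrete list [W] of written registers, the value of a preserved register is recovered by
    evaluating the membership test. *)
Definition same_off (W : seq nat) (s t : state) : Prop :=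
  forall k, k \notin W -> t.1 k = s.1 k.

Lemma triple_do s l b (Q : state -> Prop) :
  Q (foldl run1 s l) -> size l <= b -> triple s (Do l) b Q.
Proof. by []. Qed.

Lemma triple_seq s a c b1 b2 (Q1 Q : state -> Prop) : triple s a b1 Q1 ->
    (forall t, Q1 t -> same_off (writes a) s t -> triple t c b2 Q) ->
  triple s (a ;; c) (b1 + b2) Q.
Proof.
case=> q1 k1 /(_ _ q1) []; first by move=> k; apply: frame.
by move=> q k; split=> //; apply: leq_add.
Qed.

Lemma triple_le s c b b' (Q Q' : state -> Prop) : triple s c b Q ->
  b <= b' -> (forall t, same_off (writes c) s t -> Q t -> Q' t) -> triple s c b' Q'.
Proof.
case=> q k le_b QQ; split; last exact: leq_trans le_b.
by apply: QQ => // x; apply: frame.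
Qed.

Lemma triple_leq s c b b' Q : b <= b' -> triple s c b Q -> triple s c b' Q.
Proof. by move=> le_b H; apply: triple_le H le_b _. Qed.

Lemma triple_imp s c b (Q Q' : state -> Prop) : triple s c b Q ->
  (forall t, same_off (writes c) s t -> Q t -> Q' t) -> triple s c b Q'.
Proof. by move=> H; apply: triple_le H _. Qed.

Lemma triple_loop s r a n b (I : nat -> state -> Prop) :
    r != 0 -> r \notin writes a -> s.1 r = n -> I 0 s ->
    (forall i t, i < n -> same_off (writes (Loop r a)) s t -> I i t ->
       triple t a b (fun t' => I i.+1 (tock r t'))) ->
  triple s (Loop r a) (n * (b + 5)).+1 (I n).
Proof.
move=> r0 rnw En I0 IS; pose f t := tock r (den a t).
have H i : i <= n -> I i (iter i f s) /\ same_off (writes (Loop r a)) s (iter i f s).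
  elim: i => [|i IHi] lt_i; first by split.
  have [Ii fi] := IHi (ltnW lt_i); have [Ii' _] := IS _ _ lt_i fi Ii.
  split=> // k kW; move: (kW); rewrite !inE !negb_or => /and3P[k0 kr ka].
  by rewrite /= /upd (negPf k0) (negPf kr) frame ?fi.
split; first by rewrite /= En; case: (H n).
rewrite /= En ltnS -[n in n * _]card_ord -sum_nat_const; apply: leq_sum => i _.
have [Ii fi] := H i (ltnW (ltn_ord i)); have [_ ci] := IS _ _ (ltn_ord i) fi Ii.
by rewrite leq_add2r.
Qed.

(** * The dynamic programming table *)

(* Registers: 1 and 25 hold the constants 1 and 0, 2 holds |V|, 3 holds |E|,
   4 holds |C|, 5 holds |V||C|, 6 the base address of the table, 30 holds
   |V|^2; 7-12 and 29 are loop counters. While the entry (u,v,d) is relaxed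
   along the edge xy, 14 and 15 hold the offsets of x and y, 16 points to
   (u,v,0), 17 to (u,v,d), 18 to (u,x,d), 19 to (y,v,d) and 20 to (u,v,d').
   The minimum of a and b is computed as a - (a - b). *)
Definition recolour_cmd : cmd :=
  Do [:: ILoad 21 20; IAdd 21 21 1; ILoad 22 17; ISub 23 22 21; ISub 22 22 23;
         IStore 17 22; IAdd 20 20 1].

Definition split_cmd : cmd :=
  Do [:: ILoad 21 18; ILoad 24 19; IAdd 21 21 24; ILoad 22 17; ISub 23 22 21;
         ISub 22 22 23; IStore 17 22; IAdd 17 17 1; IAdd 18 18 1; IAdd 19 19 1].

Definition cell_cmd : cmd :=
  Do [:: IAdd 20 16 25; IAdd 12 4 25] ;; Loop 12 recolour_cmd ;; split_cmd.

Definition row_cmd : cmd :=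
  Do [:: IAdd 16 17 25; IAdd 11 4 25] ;; Loop 11 cell_cmd ;; Do [:: ISub 18 18 4].

Definition plane_cmd : cmd :=
  Do [:: IAdd 18 17 14; IAdd 19 6 15; IAdd 10 2 25] ;; Loop 10 row_cmd.

Definition relax_cmd : cmd :=
  Do [:: IAdd 17 6 25; IAdd 9 2 25] ;; Loop 9 plane_cmd.

(** Absorbs [k] setup instructions and the loop overhead into a multiple of the leading product,
    using that both 1 and [n] are at most [n * q]. *)
Lemma loop_cost k n q a : 0 < n -> 0 < q ->
  k + (n * (q * a + 5)).+1 <= n * q * (a + 6 + k).
Proof.
move=> n_gt0 q_gt0; have nq_gt0 : 0 < n * q by rewrite muln_gt0 n_gt0.
have le_nq : n <= n * q by rewrite leq_pmulr.
by rewrite mulnDr mulnA; nia.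
Qed.

(** * Relaxing the table along one oriented edge *)

Section Tables.
Variables (V C : finType) (f : V -> V -> C -> nat) (B : nat).
Local Notation n := #|V|.
Local Notation c := #|C|.

Definition rk (T : finType) (x : T) : nat := enum_rank x.

Lemma rkP (T : finType) i : i < #|T| -> exists x : T, rk x = i.
Proof. by move=> lt_i; exists (enum_val (Ordinal lt_i)); rewrite /rk enum_valK. Qed.

Lemma rk_lt (T : finType) (x : T) : rk x < #|T|.
Proof. exact: ltn_ord. Qed.

Lemma rk_inj (T : finType) : injective (@rk T).
Proof. by move=> x y /ord_inj/enum_rank_inj. Qed.

Definition slot (u v : V) (d : C) : nat := B + ((rk u * n + rk v) * c + rk d).

Lemma divmod_inj q a b a' b' : b < q -> b' < q -> a * q + b = a' * q + b' ->
  a = a' /\ b = b'.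
Proof.
move=> ltb ltb' E; have q_gt0 : 0 < q by lia.
split; first by have := congr1 (divn^~ q) E; rewrite /= !divnMDl // !divn_small // !addn0.
by have := congr1 (modn^~ q) E; rewrite /= !modnMDl !modn_small.
Qed.

Lemma slot_inj u v d u' v' d' : slot u v d = slot u' v' d' ->
  [/\ u = u', v = v' & d = d'].
Proof.
move/addnI/divmod_inj=> /(_ (rk_lt _) (rk_lt _))[E /rk_inj ->].
by case/divmod_inj: E => [||/rk_inj -> /rk_inj ->]; rewrite ?rk_lt.
Qed.

Lemma pair_lt_square (u v : V) : rk u * n + rk v < n * n.
Proof.
apply: leq_trans (_ : (rk u).+1 * n <= _); last by rewrite leq_mul2r rk_lt orbT.
by rewrite mulSnr ltn_add2l rk_lt.
Qed.

Lemma slot_lt_table u v d : slot u v d < B + n * n * c.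
Proof.
rewrite ltn_add2l; apply: leq_trans (_ : (rk u * n + rk v).+1 * c <= _).
  by rewrite mulSnr ltn_add2l rk_lt.
by rewrite leq_mul2r pair_lt_square orbT.
Qed.

Definition sound (M : nat -> nat) : Prop := forall u v d, f u v d <= M (slot u v d).

Definition shrunk (M0 M : nat -> nat) : Prop :=
  [/\ forall a, a < B -> M a = M0 a, forall a, M a <= M0 a & sound M].

Lemma shrunk_refl M : sound M -> shrunk M M.
Proof. by split. Qed.

Lemma shrunk_trans M0 M1 M2 : shrunk M0 M1 -> shrunk M1 M2 -> shrunk M0 M2.
Proof.
case=> E1 l1 _ [E2 l2 s2]; split=> // a; first by move=> aB; rewrite E2 ?E1.
exact: leq_trans (l1 a).
Qed.

Definition lower (M : nat -> nat) a z : nat -> nat := upd M a (M a - (M a - z)).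

Lemma lower_at M a z : lower M a z a <= z.
Proof. by rewrite /lower /upd eqxx; lia. Qed.

Lemma lower_le M a z b : lower M a z b <= M b.
Proof. by rewrite /lower /upd; case: eqP => [->|_] //; lia. Qed.

Lemma lower_shrunk M0 M u v d z : shrunk M0 M -> f u v d <= z ->
  shrunk M0 (lower M (slot u v d) z).
Proof.
case=> E l s fz; split.
- move=> a aB; rewrite -E // /lower /upd ifN //; apply/eqP.
  by rewrite /slot; lia.
- by move=> a; apply: leq_trans (lower_le _ _ _ _) (l a).
move=> u' v' d'; rewrite /lower /upd; case: eqP => [E'|_ //].
by case: (slot_inj E') => -> -> ->; have := s u v d; lia.
Qed.

(** The table is updated in place, so entries being read may already have been lowered. Comparing
    with the table [M0] from before the sweep gives a condition that later decreases preserve. *)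
Definition relaxed (M0 M : nat -> nat) (x y : V) (u v : V) (d : C) : Prop :=
  M (slot u v d) <= M0 (slot u x d) + M0 (slot y v d) /\
  forall d', M (slot u v d) <= (M0 (slot u v d')).+1.

(** The sweep visits the entries in address order, so the nested loops share one measure of
    progress, the pointer in register 17. *)
Definition relaxed_upto (M0 M : nat -> nat) x y (p : nat) : Prop :=
  forall u v d, slot u v d < p -> relaxed M0 M x y u v d.

Lemma relaxed_upto_le M0 M M' x y p : relaxed_upto M0 M x y p ->
  (forall a, M' a <= M a) -> relaxed_upto M0 M' x y p.
Proof.
move=> H le_M u v d /H[H1 H2].
by split=> [|d']; apply: leq_trans (le_M _) _.
Qed.

Lemma relaxed_uptoS M0 M x y u v d : relaxed_upto M0 M x y (slot u v d) ->
  relaxed M0 M x y u v d -> relaxed_upto M0 M x y (slot u v d).+1.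
Proof.
move=> H Huvd u' v' d'; rewrite ltnS leq_eqVlt => /orP[/eqP E|/H //].
by case: (slot_inj E) => -> -> ->.
Qed.

Definition consts (s : state) : Prop :=
  [/\ s.1 1 = 1, s.1 2 = n, s.1 4 = c, s.1 6 = B & s.1 25 = 0] /\ s.1 5 = n * c.

Lemma consts_off W s t : consts s -> same_off W s t ->
  all (fun k => k \notin W) [:: 1; 2; 4; 5; 6; 25] -> consts t.
Proof.
by case=> -[? ? ? ? ?] ? st /and5P[? ? ? ? /and3P[? ? _]]; rewrite /consts !st.
Qed.

Hypothesis f_recol : forall u v d d', f u v d <= (f u v d').+1.

Lemma recolour_spec M0 x y u v d s : consts s ->
    s.1 16 = B + (rk u * n + rk v) * c -> s.1 20 = s.1 16 -> s.1 12 = c ->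
    s.1 17 = slot u v d ->
    shrunk M0 s.2 -> relaxed_upto M0 s.2 x y (slot u v d) ->
  triple s (Loop 12 recolour_cmd) (c * 12).+1 (fun t =>
    [/\ shrunk M0 t.2, relaxed_upto M0 t.2 x y (slot u v d) &
        forall d', t.2 (slot u v d) <= (M0 (slot u v d')).+1]).
Proof.
move=> cs E16 E20 E12 E17 sh up.
pose I i (t : state) := [/\ t.1 20 = s.1 16 + i, shrunk M0 t.2,
  relaxed_upto M0 t.2 x y (slot u v d) &
  forall d', rk d' < i -> t.2 (slot u v d) <= (M0 (slot u v d')).+1].
apply: (@triple_imp _ _ _ (I c)); last first.
  by move=> t _ [_ sh' up' H]; split=> // d'; apply/H/rk_lt.
apply: (@triple_loop _ _ _ c 7) => //; first by split; rewrite ?addn0.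
move=> i t lt_i st [t20 sht upt Ht]; apply: triple_do => //.
have [[t1 _ _ _ _] _] := consts_off cs st isT.
have t17 : t.1 17 = slot u v d by rewrite st.
have [di rdi] := rkP lt_i.
have t20' : t.1 20 = slot u v di by rewrite t20 E16 /slot rdi addnA.
rewrite /I /tock /= /upd /= t1 -/(upd _ _ _) t17 t20' -/(lower _ _ _).
have shl : shrunk M0 (lower t.2 (slot u v d) (t.2 (slot u v di) + 1)).
  apply: lower_shrunk => //; apply: leq_trans (f_recol _ _ _ di) _.
  by rewrite addn1 ltnS; case: sht.
split=> //.
- by rewrite -t20' t20; lia.
- by apply: relaxed_upto_le upt _ => a; apply: lower_le.
move=> d'; rewrite ltnS leq_eqVlt => /orP[/eqP|/Ht H]; last first.
  exact: leq_trans (lower_le _ _ _ _) H.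
rewrite -rdi => /rk_inj ->; apply: leq_trans (lower_at _ _ _) _.
by rewrite addn1 ltnS; case: sht.
Qed.

Section Relax.
Variables (x y : V) (M0 : nat -> nat).
Hypothesis f_split : forall u v d, f u v d <= f u x d + f y v d.

Lemma cell_spec u v d s : consts s ->
    s.1 16 = B + (rk u * n + rk v) * c -> s.1 17 = slot u v d ->
    s.1 18 = slot u x d -> s.1 19 = slot y v d ->
    shrunk M0 s.2 -> relaxed_upto M0 s.2 x y (slot u v d) ->
  triple s cell_cmd (c * 25) (fun t =>
    [/\ t.1 17 = (slot u v d).+1, t.1 18 = (slot u x d).+1,
        t.1 19 = (slot y v d).+1, shrunk M0 t.2 &
        relaxed_upto M0 t.2 x y (slot u v d).+1]).
Proof.
move=> cs E16 E17 E18 E19 sh up.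
have c_gt0 : 0 < c by apply: leq_trans (rk_lt d).
(* As [c] is positive, the 13 instructions outside the colour passes are absorbed into [c * 25]. *)
apply: (@triple_leq _ _ (2 + ((c * 12).+1 + 10))); first by lia.
apply: (@triple_seq _ _ _ _ _ (fun t => [/\ t.1 20 = s.1 16, t.1 12 = c & t.2 = s.2])).
  by apply: triple_do => //; case: cs => -[_ _ s4 _ s25] _;
     rewrite /= /upd /= s25 s4 !addn0.
move=> t [t20 t12 tM] st; have ct := consts_off cs st isT.
apply: triple_seq.
  by apply: (@recolour_spec M0 x y u v d t) => //; rewrite ?tM ?t20 ?st.
move=> s2 [sh2 up2 H2] st2; apply: triple_do => //.
have e17 : s2.1 17 = slot u v d by rewrite st2 // st.
have e18 : s2.1 18 = slot u x d by rewrite st2 // st.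
have e19 : s2.1 19 = slot y v d by rewrite st2 // st.
have [[s1 _ _ _ _] _] := consts_off ct st2 isT.
rewrite /= /upd /= -/(upd _ _ _) e17 e18 e19 s1 -/(lower _ _ _).
set z := s2.2 _ + s2.2 _.
have le_z : z <= M0 (slot u x d) + M0 (slot y v d).
  by case: sh2 => _ l _; apply: leq_add.
split; rewrite ?addn1 //.
  apply: lower_shrunk => //; apply: leq_trans (f_split _ _ _) _.
  by case: sh2 => _ _ sd; apply: leq_add.
apply: relaxed_uptoS.
  by apply: relaxed_upto_le up2 _ => a; apply: lower_le.
split; first exact: leq_trans (lower_at _ _ _) le_z.
by move=> d'; apply: leq_trans (lower_le _ _ _ _) _.
Qed.

Lemma row_spec (u v : V) s : consts s -> 0 < c ->
    s.1 17 = B + (rk u * n + rk v) * c ->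
    s.1 18 = B + (rk u * n + rk x) * c -> s.1 19 = B + (rk y * n + rk v) * c ->
    shrunk M0 s.2 -> relaxed_upto M0 s.2 x y (s.1 17) ->
  triple s row_cmd (c * c * 34) (fun t =>
    [/\ t.1 17 = B + (rk u * n + rk v).+1 * c, t.1 18 = s.1 18,
        t.1 19 = B + (rk y * n + rk v).+1 * c, shrunk M0 t.2 &
        relaxed_upto M0 t.2 x y (t.1 17)]).
Proof.
move=> cs c_gt0 E17 E18 E19 sh up.
apply: (@triple_leq _ _ (2 + ((c * (c * 25 + 5)).+1 + 1))); first by nia.
apply: (@triple_seq _ _ _ _ _ (fun t => [/\ t.1 16 = s.1 17, t.1 11 = c & t.2 = s.2])).
  by apply: triple_do => //; case: cs => -[_ _ s4 _ s25] _;
     rewrite /= /upd /= s25 s4 !addn0.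
move=> t [t16 t11 tM] st; have ct := consts_off cs st isT.
apply: (@triple_seq _ _ _ _ _ (fun t' => [/\ t'.1 17 = s.1 17 + c,
  t'.1 18 = s.1 18 + c, t'.1 19 = s.1 19 + c, shrunk M0 t'.2 &
  relaxed_upto M0 t'.2 x y (t'.1 17)])).
  apply: (@triple_loop _ _ _ _ _ (fun i t' => [/\ t'.1 17 = s.1 17 + i,
    t'.1 18 = s.1 18 + i, t'.1 19 = s.1 19 + i, shrunk M0 t'.2 &
    relaxed_upto M0 t'.2 x y (t'.1 17)])) => //.
    by rewrite !addn0 tM !st.
  move=> i t1 lt_i st1 [t17 t18 t19 sh1 up1]; have [d rd] := rkP lt_i.
  have e17 : t1.1 17 = slot u v d by rewrite t17 E17 /slot rd addnA.
  have e18 : t1.1 18 = slot u x d by rewrite t18 E18 /slot rd addnA.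
  have e19 : t1.1 19 = slot y v d by rewrite t19 E19 /slot rd addnA.
  apply: triple_imp (@cell_spec u v d t1 _ _ e17 e18 e19 sh1 _) _ => //.
  - exact: consts_off ct st1 isT.
  - by rewrite st1 // t16.
  - by rewrite -e17.
  move=> t2 _ [e17' e18' e19' sh2 up2].
  rewrite /tock /= /upd /= e17' e18' e19' -e17 -e18 -e19 t17 t18 t19 -!addnS.
  by rewrite -e17 t17 -addnS in up2.
(* Pointer 18 is wound back by [c] because x stays fixed while v advances; pointers 17 and 19
   already stand at the next v. *)
move=> t1 [t17 t18 t19 sh1 up1] st1; apply: triple_do => //.
have [[_ _ t4 _ _] _] := consts_off ct st1 isT.
rewrite /= /upd /= t4 t17 t18 t19 E17 E18 E19 addnK; split=> //.
- by rewrite -addnA -mulSnr.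
- by rewrite -addnA -mulSnr.
by rewrite -E17 -t17.
Qed.

Lemma plane_spec (u : V) s : consts s -> 0 < c ->
    s.1 14 = rk x * c -> s.1 15 = rk y * (n * c) ->
    s.1 17 = B + rk u * n * c ->
    shrunk M0 s.2 -> relaxed_upto M0 s.2 x y (s.1 17) ->
  triple s plane_cmd (n * c * c * 43) (fun t =>
    [/\ t.1 17 = B + (rk u).+1 * n * c, shrunk M0 t.2 &
        relaxed_upto M0 t.2 x y (t.1 17)]).
Proof.
move=> cs c_gt0 E14 E15 E17 sh up.
have n_gt0 : 0 < n by apply: leq_trans (rk_lt u).
apply: (@triple_leq _ _ (3 + (n * (c * c * 34 + 5)).+1)).
  by rewrite -(mulnA n); apply: (@loop_cost 3) => //; rewrite muln_gt0 c_gt0.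
(* Pointer 17 stands at the start of the plane of u, so adding the offset of x reaches [(u,x,0)];
   pointer 19 restarts at the plane of y. *)
apply: (@triple_seq _ _ _ _ _ (fun t => [/\ t.1 18 = B + (rk u * n + rk x) * c,
  t.1 19 = B + (rk y * n) * c, t.1 10 = n & t.2 = s.2])).
  apply: triple_do => //; case: cs => -[_ s2 _ s6 s25] _.
  by rewrite /= /upd /= s25 s2 s6 E14 E15 E17 !addn0 mulnA mulnDl addnA.
move=> t [t18 t19 t10 tM] st; have ct := consts_off cs st isT.
apply: (@triple_imp _ _ _ (fun t' => [/\ t'.1 17 = B + (rk u * n + n) * c,
    t'.1 18 = t.1 18, t'.1 19 = B + (rk y * n + n) * c, shrunk M0 t'.2 &
    relaxed_upto M0 t'.2 x y (t'.1 17)])); last first.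
  by move=> t' _ [t17' _ _ sh' up']; split=> //; rewrite t17' -mulSnr.
apply: (@triple_loop _ _ _ n _ (fun i t' => [/\ t'.1 17 = B + (rk u * n + i) * c,
    t'.1 18 = t.1 18, t'.1 19 = B + (rk y * n + i) * c, shrunk M0 t'.2 &
    relaxed_upto M0 t'.2 x y (t'.1 17)])) => //.
  by rewrite !addn0 t19 tM -E17 (st 17).
move=> i t1 lt_i st1 [e17 e18 e19 sh1 up1]; have [v rv] := rkP lt_i.
apply: triple_imp (@row_spec u v t1 _ c_gt0 _ _ _ sh1 up1) _ => //.
- exact: consts_off ct st1 isT.
- by rewrite rv.
- by rewrite e18.
- by rewrite rv.
move=> t2 _ [e17' e18' e19' sh2 up2].
by rewrite /tock /= /upd /= e17' e18' e19' e18 rv -!addnS -rv addnS -e17'.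
Qed.

Lemma relax_spec s : consts s -> 0 < c ->
    s.1 14 = rk x * c -> s.1 15 = rk y * (n * c) -> shrunk M0 s.2 ->
  triple s relax_cmd (n * n * c * c * 51) (fun t =>
    shrunk M0 t.2 /\ forall u v d, relaxed M0 t.2 x y u v d).
Proof.
move=> cs c_gt0 E14 E15 sh.
have n_gt0 : 0 < n by apply: leq_trans (rk_lt x).
apply: (@triple_leq _ _ (2 + (n * (n * c * c * 43 + 5)).+1)).
  have -> : n * n * c * c = n * (n * c * c) by rewrite !mulnA.
  apply: (@loop_cost 2) => //.
  by rewrite !muln_gt0 n_gt0 c_gt0.
apply: (@triple_seq _ _ _ _ _ (fun t => [/\ t.1 17 = B, t.1 9 = n & t.2 = s.2])).
  by apply: triple_do => //; case: cs => -[_ s2 _ s6 s25] _;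
     rewrite /= /upd /= s25 s2 s6 !addn0.
move=> t [t17 t9 tM] st; have ct := consts_off cs st isT.
apply: (@triple_imp _ _ _ (fun t' => [/\ t'.1 17 = B + n * n * c, shrunk M0 t'.2 &
    relaxed_upto M0 t'.2 x y (t'.1 17)])); last first.
  move=> t' _ [t17' sh' up']; split=> // u v d; apply: up'.
  by rewrite t17' slot_lt_table.
apply: (@triple_loop _ _ _ n _ (fun i t' => [/\ t'.1 17 = B + i * n * c,
    shrunk M0 t'.2 & relaxed_upto M0 t'.2 x y (t'.1 17)])) => //.
  rewrite tM t17 addn0; split=> // u v d; rewrite /slot; lia.
move=> i t1 lt_i st1 [e17 sh1 up1]; have [u ru] := rkP lt_i.
apply: triple_imp (@plane_spec u t1 _ c_gt0 _ _ _ sh1 up1) _ => //.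
- exact: consts_off ct st1 isT.
- by rewrite st1 // st.
- by rewrite st1 // st.
- by rewrite ru.
by move=> t2 _ [e17' sh2 up2]; rewrite /tock /= /upd /= e17' -ru -e17'.
Qed.

End Relax.

End Tables.

(** * The phases of the program *)

Definition mul_cmd (t x k : nat) : cmd :=
  Do [:: IConst t 0; IAdd 12 k 25] ;; Loop 12 (Do [:: IAdd t t x]).

Lemma mul_spec t x k s : t \notin [:: 0; 12; 25; k; x] -> x \notin [:: 0; 12] ->
    s.1 25 = 0 ->
  triple s (mul_cmd t x k) (3 + s.1 k * 6) (fun s' =>
    s'.1 t = s.1 k * s.1 x /\ s'.2 = s.2).
Proof.
rewrite !inE !negb_or !(eq_sym t) => /and5P[t0 t12 t25 tk tx] /andP[x0 x12] s25.
apply: (@triple_leq _ _ (2 + (s.1 k * (1 + 5)).+1)); first by lia.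
apply: (@triple_seq _ _ _ _ _ (fun s' =>
  [/\ s'.1 t = 0, s'.1 12 = s.1 k, s'.1 x = s.1 x & s'.2 = s.2])).
  apply: triple_do => //=.
  by rewrite /upd /= !(eq_sym t) (negPf t12) (negPf t25) (negPf tk) (negPf tx)
             (negPf x12) eqxx s25 addn0.
move=> s1 [st s12 sx sM] _.
apply: (@triple_imp _ _ _ (fun s' =>
    [/\ s'.1 t = s.1 k * s.1 x, s'.1 x = s.1 x & s'.2 = s.2])); last first.
  by move=> s' _ [].
apply: (@triple_loop _ _ _ (s.1 k) _ (fun i s' =>
    [/\ s'.1 t = i * s.1 x, s'.1 x = s.1 x & s'.2 = s.2])) => //.
  by rewrite /= inE.
move=> i s' _ _ [e1 e2 e3]; apply: triple_do => //=.
by rewrite /upd /= !(eq_sym t) (negPf t12) (negPf t0) (negPf tx) (negPf x0)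
           (negPf x12) eqxx e1 e2 mulSnr.
Qed.

(** Treats one orientation of an edge; [edge_cmd] runs it for both, exchanging the endpoints held in
    registers 26 and 27. *)
Definition half_cmd : cmd := mul_cmd 14 26 4 ;; mul_cmd 15 27 5 ;; relax_cmd.

Definition edge_cmd : cmd :=
  Do [:: ILoad 26 13; IAdd 13 13 1; ILoad 27 13; IAdd 13 13 1] ;;
  half_cmd ;;
  Do [:: IAdd 28 26 25; IAdd 26 27 25; IAdd 27 28 25] ;;
  half_cmd.

Definition round_cmd : cmd :=
  Do [:: IConst 13 3; IAdd 13 13 2; IAdd 8 3 25] ;; Loop 8 edge_cmd.

Definition rounds_cmd : cmd := Do [:: IAdd 7 2 2] ;; Loop 7 round_cmd.

Definition fill_cmd : cmd :=
  mul_cmd 26 5 2 ;; Do [:: IAdd 17 6 25] ;;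
  Loop 26 (Do [:: IStore 17 2; IAdd 17 17 1]).

(** Consecutive diagonal blocks [(u,u)] lie |V||C| + |C| cells apart; the offset inside a block is
    the colour read from the input. *)
Definition diagonal_cmd : cmd :=
  Do [:: IConst 13 3; IAdd 17 6 25; IAdd 12 2 25] ;;
  Loop 12 (Do [:: ILoad 21 13; IAdd 21 21 17; IStore 21 25; IAdd 13 13 1;
                  IAdd 17 17 5; IAdd 17 17 4]).

Definition pair_cmd : cmd :=
  Do [:: IAdd 22 2 25; IAdd 12 4 25] ;;
  Loop 12 (Do [:: ILoad 21 17; ISub 23 22 21; ISub 22 22 23; IAdd 17 17 1]) ;;
  Do [:: IStore 18 22; IAdd 18 18 1].

Definition output_cmd : cmd :=
  Do [:: IConst 18 0; IAdd 17 6 25; IAdd 9 30 25] ;; Loop 9 pair_cmd.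

(** * Correctness and cost of each phase *)

Section Instance.
Variables (V C : finType) (e : rel V) (w : colouring V C) (es : seq (V * V)).
Variables (B : nat) (inp : nat -> nat).
Hypothesis e_sym : symmetric e.
Hypothesis e_conn : connected_graph e.
Hypothesis es_e : forall p, p \in es -> e p.1 p.2.
Hypothesis e_es : forall x y, e x y -> (x, y) \in es \/ (y, x) \in es.
Hypothesis es_gt0 : 0 < size es.
Hypothesis inp_colour : forall v, inp (3 + rk v) = rk (w v).
Hypothesis inp_edge : forall q i, i < size es ->
  inp (3 + #|V| + i.*2) = rk (nth q es i).1 /\
  inp (3 + #|V| + i.*2).+1 = rk (nth q es i).2.
Hypothesis input_lt_base : 3 + #|V| + (size es).*2 <= B.
Hypothesis output_lt_base : #|V| * #|V| <= B.

Local Notation n := #|V|.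
Local Notation c := #|C|.
Local Notation f := (m3 e_conn w).
Local Notation q := (n * n * c * c).
Local Notation cell := (@slot V C B).
Local Notation consts := (@consts V C B).
Local Notation sound := (sound f B).
Local Notation shrunk := (shrunk f B).
Local Notation relaxed := (@relaxed V C B).

Let f_recol u v d d' : f u v d <= (f u v d').+1.
Proof. exact: m3_recol. Qed.

Let n_gt0 : 0 < n.
Proof. by case: es es_gt0 => // -[x y] _ _; apply/card_gt0P; exists x. Qed.

Let c_gt0 : 0 < c.
Proof. by case: es es_gt0 => // -[x y] _ _; apply/card_gt0P; exists (w x). Qed.

Let q_gt0 : 0 < q.
Proof. by rewrite !muln_gt0 n_gt0 c_gt0. Qed.

Lemma relaxed_mono M0 M0' M M' x y (u v : V) (d : C) :
    relaxed M0 M x y u v d ->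
    (forall a, M0 a <= M0' a) -> (forall a, M' a <= M a) ->
  relaxed M0' M' x y u v d.
Proof.
case=> H1 H2 le0 le; split=> [|d']; apply: leq_trans (le _) _.
  by apply: leq_trans H1 _; apply: leq_add.
by apply: leq_trans (H2 d') _; rewrite ltnS.
Qed.

Lemma half_spec x y s : consts s -> e x y -> s.1 26 = rk x -> s.1 27 = rk y ->
    sound s.2 ->
  triple s half_cmd (q * 69) (fun t =>
    shrunk s.2 t.2 /\ forall u v d, relaxed s.2 t.2 x y u v d).
Proof.
move=> cs exy s26 s27 snd.
have [[_ _ s4 _ s25] s5] := cs.
(* Since [c] and [n * c] are at most [q], the two multiplications cost at most [q * 18]. *)
apply: (@triple_leq _ _ ((3 + c * 6) + ((3 + n * c * 6) + q * 51))).
  have le1 : c <= q by rewrite leq_pmull // !muln_gt0 n_gt0 c_gt0.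
  have le2 : n * c <= q.
    by rewrite -mulnA mulnACA leq_pmulr // muln_gt0 n_gt0.
  by lia.
apply: (triple_seq (Q1 := fun t => t.1 14 = rk x * c /\ t.2 = s.2)).
  by rewrite -s4; apply: triple_imp (mul_spec _ _ s25) _ => // t _ [-> ->];
     rewrite s26 mulnC.
move=> t [t14 tM] st; have ct := consts_off cs st isT.
have [[_ _ _ _ t25] t5] := ct.
apply: (triple_seq (Q1 := fun t' => t'.1 15 = rk y * (n * c) /\ t'.2 = t.2)).
  rewrite -[in X in 3 + X]t5; apply: triple_imp (mul_spec _ _ t25) _ => // t' _ [-> ->].
  by rewrite t5 mulnC (st 27) // s27.
move=> t1 [t15 tM1] st1; have ct1 := consts_off ct st1 isT.
have E : t1.2 = s.2 by rewrite tM1.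
apply: (relax_spec f_recol) => //.
- by move=> u v d; apply: m3_split.
- by rewrite st1.
- by rewrite E; apply: shrunk_refl.
Qed.

Lemma round_spec s : consts s -> s.1 3 = size es ->
    (forall a, a < B -> s.2 a = inp a) -> sound s.2 ->
  triple s round_cmd (size es * q * 154) (fun t => shrunk s.2 t.2 /\
    forall x y, e x y -> forall u v d, relaxed s.2 t.2 x y u v d).
Proof.
move=> cs s3 sinp snd; have [[_ s2 _ _ s25] _] := cs.
apply: (@triple_leq _ _ (3 + (size es * (q * 145 + 5)).+1)).
  exact: (@loop_cost 3).
apply: (triple_seq (Q1 := fun t => [/\ t.1 13 = 3 + n, t.1 8 = size es & t.2 = s.2])).
  by apply: triple_do => //=; rewrite /upd /= s2 s3 s25 addn0.
move=> t [t13 t8 tM] st; have ct := consts_off cs st isT.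
(* Each edge is listed once, in an unknown orientation, so both orientations are recorded. *)
pose done_to i (t' : state) := forall p j, j < i ->
  let: (x, y) := nth p es j in
  forall u v d, relaxed s.2 t'.2 x y u v d /\ relaxed s.2 t'.2 y x u v d.
apply: (@triple_imp _ _ _ (fun t' => [/\ t'.1 13 = 3 + n + (size es).*2,
    shrunk s.2 t'.2 & done_to (size es) t'])); last first.
  move=> t' _ [_ sh dn]; split=> // x y exy u v d.
  case: (e_es exy) => /(nthP (x, y))[j lt_j Ej].
    by have := dn (x, y) j lt_j; rewrite Ej => /(_ u v d)[].
  by have := dn (x, y) j lt_j; rewrite Ej => /(_ u v d)[].
apply: (@triple_loop _ _ _ (size es) _ (fun i t' => [/\ t'.1 13 = 3 + n + i.*2,
    shrunk s.2 t'.2 & done_to i t'])) => //.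
  by rewrite addn0 tM; split=> //; apply: shrunk_refl.
move=> i t1 lt_i st1 [t13' sh1 dn1].
have [p0 Ep0] : exists p0, p0 \in es.
  by case: (es) es_gt0 => // p0 s' _; exists p0; rewrite mem_head.
have ct1 := consts_off ct st1 isT.
case Ep: (nth p0 es i) => [x y].
have exy : e x y.
  by have := es_e (mem_nth p0 lt_i); rewrite Ep.
have [ix iy] := inp_edge p0 lt_i; rewrite Ep /= in ix iy.
have [[c1 _ _ _ c25] _] := ct1.
have inp1 a : a < B -> t1.2 a = inp a.
  by move=> aB; case: sh1 => -> // _ _; apply: sinp.
have lt1 : 3 + n + i.*2 < B by apply: leq_trans input_lt_base; rewrite ltn_add2l ltn_double.
have lt2 : (3 + n + i.*2).+1 < B.
  apply: leq_trans input_lt_base; rewrite -addnS ltn_add2l.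
  by rewrite -[_.*2.+2]doubleS leq_double.
apply: (@triple_leq _ _ (4 + (q * 69 + (3 + q * 69)))); first by lia.
apply: (triple_seq (Q1 := fun t' => [/\ t'.1 26 = rk x, t'.1 27 = rk y,
    t'.1 13 = 3 + n + i.+1.*2 & t'.2 = t1.2])).
  apply: triple_do => //=; rewrite /upd /= c1 t13' !addn1 !inp1 // ix iy; split=> //.
  by rewrite doubleS !addnS.
move=> t2 [e26 e27 e13 eM] st2; have ct2 := consts_off ct1 st2 isT.
apply: (triple_seq (half_spec ct2 exy e26 e27 _)).
  by rewrite eM; case: sh1.
move=> t3 [sh3 rl3] st3; have ct3 := consts_off ct2 st3 isT.
have [[_ _ _ _ c25'] _] := ct3.
apply: (triple_seq (Q1 := fun t' => [/\ t'.1 26 = rk y, t'.1 27 = rk x & t'.2 = t3.2])).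
  by apply: triple_do => //=; rewrite /upd /= c25' !addn0 (st3 26) // (st3 27).
move=> t4 [e26' e27' eM'] st4; have ct4 := consts_off ct3 st4 isT.
have eyx : e y x by rewrite e_sym.
apply: triple_imp (half_spec ct4 eyx e26' e27' _) _.
  by rewrite eM'; case: sh3.
move=> t5 st5 [sh5 rl5].
have e13' : t5.1 13 = 3 + n + i.+1.*2 by rewrite st5 // st4 // st3.
have sh15 : shrunk t1.2 t5.2.
  by rewrite -eM; apply: shrunk_trans sh3 _; rewrite -eM'.
have le10 a : t1.2 a <= s.2 a by case: sh1.
have le51 a : t5.2 a <= t1.2 a by case: sh15.
have le53 a : t5.2 a <= t3.2 a by rewrite -eM'; case: sh5.
have le31 a : t3.2 a <= t1.2 a by rewrite -eM; case: sh3.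
split; [exact: e13'|exact: shrunk_trans sh1 sh15|].
move=> p j; rewrite ltnS leq_eqVlt => /orP[/eqP ->|lt_j]; last first.
  have := dn1 p j lt_j; case: (nth p es j) => x' y' H u v d.
  by case: (H u v d) => H1 H2; split;
    [apply: relaxed_mono H1 _ _|apply: relaxed_mono H2 _ _].
(* The first orientation stays relaxed because later updates only decrease entries; the second was
   relaxed against a table already below the initial one. *)
rewrite (set_nth_default p0) // Ep => u v d; split.
  by apply: relaxed_mono (rl3 u v d) _ _ => // a; rewrite eM.
apply: relaxed_mono (rl5 u v d) _ _ => // a; rewrite eM'.
exact: leq_trans (le31 a) _.
Qed.

(** After [r] rounds each entry is at most the cost of every derivation of depth [r]. Soundness
    bounds it from below, so by [m3_bder] it is exact after 2|V| rounds. *)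
Lemma rounds_spec s : consts s -> s.1 3 = size es ->
    (forall a, a < B -> s.2 a = inp a) -> sound s.2 ->
    (forall u, s.2 (cell u u (w u)) = 0) ->
  triple s rounds_cmd (n * (size es * q) * 322) (fun t =>
    forall u v d, t.2 (cell u v d) = f u v d).
Proof.
move=> cs s3 sinp snd leaf; have [[_ s2 _ _ _] _] := cs.
apply: (@triple_leq _ _ (1 + ((n + n) * (size es * q * 154 + 5)).+1)).
  have -> : n * (size es * q) * 322 = (n + n) * (size es * q) * (154 + 6 + 1).
    by rewrite addnn -muln2; lia.
  by apply: loop_cost; rewrite ?addn_gt0 ?n_gt0 // muln_gt0 es_gt0.
apply: (triple_seq (Q1 := fun t => t.1 7 = n + n /\ t.2 = s.2)).
  by apply: triple_do => //=; rewrite /upd /= s2.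
move=> t [t7 tM] st; have ct := consts_off cs st isT.
apply: (@triple_imp _ _ _ (fun t' => [/\ forall a, a < B -> t'.2 a = inp a,
    sound t'.2 & forall u v d k, bder e w (n + n) u v d k ->
      t'.2 (cell u v d) <= k])); last first.
  move=> t' _ [_ snd' cmp] u v d; apply/eqP; rewrite eqn_leq snd' andbT.
  have [k le_k] := m3_bder e_sym e_conn w u v d; rewrite -addnn => /cmp H.
  exact: leq_trans le_k.
apply: (@triple_loop _ _ _ (n + n) _ (fun r t' => [/\ forall a, a < B -> t'.2 a = inp a,
    sound t'.2 & forall u v d k, bder e w r u v d k ->
      t'.2 (cell u v d) <= k])) => //.
  (* Only leaves have depth 0, and their entries are the zeros set on the diagonal. *)
  rewrite tM; split=> // u v d k H.
  move Er: 0 H => r H; case: H Er => // r' u' _; by rewrite leaf.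
move=> r t1 _ st1 [inp1 snd1 cmp1].
have t13 : t1.1 3 = size es by rewrite st1 // st.
apply: triple_imp (round_spec (consts_off ct st1 isT) t13 inp1 snd1) _.
move=> t2 _ [[E2 l2 snd2] rl2]; rewrite /tock /=; split=> //.
  by move=> a aB; rewrite E2 ?inp1.
(* Recolourings are relaxed only while some edge is processed; any edge provides them. *)
have [x [y exy]] : exists x y, e x y.
  case: (es) es_gt0 es_e => // -[x y] s' _ H; exists x, y.
  by apply: (H (x, y)); rewrite mem_head.
move=> u v d k H; move Er: r.+1 H => r' H.
case: H Er => {r' u v d k} 
  [r' u _|r' u v a d k H [Er]|r' u x' y' v d k l H exy' H' [Er]].
- exact: leq_trans (l2 _) (cmp1 _ _ _ _ (bder_leaf _ _ _ _)).
- have [_ H2] := rl2 x y exy u v d; apply: leq_trans (H2 a) _.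
  by rewrite ltnS; apply: cmp1; rewrite Er.
have [H1 _] := rl2 x' y' exy' u v d; apply: leq_trans H1 _.
by apply: leq_add; apply: cmp1; rewrite Er.
Qed.

Lemma fill_spec s : consts s ->
  triple s fill_cmd (n * n * c * 18) (fun t =>
    (forall a, a < B -> t.2 a = s.2 a) /\ forall u v d, t.2 (cell u v d) = n).
Proof.
move=> cs; have [[_ s2 _ _ s25] s5] := cs.
apply: (@triple_leq _ _ ((3 + n * 6) + (1 + (n * (n * c) * (2 + 5)).+1))).
  have le1 : n <= n * n * c by rewrite -mulnA leq_pmulr // muln_gt0 n_gt0.
  by rewrite mulnA; move: n_gt0 le1; lia.
apply: (triple_seq (Q1 := fun t => t.1 26 = n * (n * c) /\ t.2 = s.2)).
  rewrite -[in X in 3 + X]s2; apply: triple_imp (mul_spec _ _ s25) _ => // t _ [-> ->].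
  by rewrite s2 s5.
move=> t [t26 tM] st; have ct := consts_off cs st isT.
have [[_ _ _ t6 t25] _] := ct.
apply: (triple_seq (Q1 := fun t' => t'.1 17 = B /\ t'.2 = s.2)).
  by apply: triple_do => //=; rewrite /upd /= t6 t25 addn0.
move=> t1 [t17 tM1] st1; have ct1 := consts_off ct st1 isT.
have t126 : t1.1 26 = n * (n * c) by rewrite st1.
apply: (@triple_imp _ _ _ (fun t' => [/\ t'.1 17 = B + n * (n * c),
    forall a, a < B -> t'.2 a = s.2 a &
    forall j, j < n * (n * c) -> t'.2 (B + j) = n])); last first.
  move=> t' _ [_ lo hi]; split=> // u v d; apply: hi.
  have := slot_lt_table B u v d; rewrite /slot ltn_add2l mulnA; apply.
apply: (@triple_loop _ _ _ (n * (n * c)) _ (fun i t' => [/\ t'.1 17 = B + i,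
    forall a, a < B -> t'.2 a = s.2 a & forall j, j < i -> t'.2 (B + j) = n])) => //.
  by rewrite addn0 tM1.
move=> i t' _ st' [e17 lo hi]; have [[c1 c2 _ _ _] _] := consts_off ct1 st' isT.
apply: triple_do => //=; rewrite /upd /= e17 c1 c2 addn1 addnS; split=> //.
  by move=> a aB; rewrite ifN ?lo // neq_ltn (leq_trans aB) // leq_addr.
move=> j; rewrite eqn_add2l ltnS leq_eqVlt; case: eqP => //= _; exact: hi.
Qed.

Lemma diagonal_spec s : consts s -> (forall a, a < B -> s.2 a = inp a) ->
    (forall u v d, s.2 (cell u v d) = n) ->
  triple s diagonal_cmd (n * 15) (fun t => [/\ forall a, a < B -> t.2 a = inp a,
    sound t.2 & forall u, t.2 (cell u u (w u)) = 0]).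
Proof.
move=> cs sinp full; have [[_ s2 _ s6 s25] _] := cs.
apply: (@triple_leq _ _ (3 + (n * (6 + 5)).+1)); first by lia.
apply: (triple_seq (Q1 := fun t => [/\ t.1 13 = 3, t.1 17 = B, t.1 12 = n & t.2 = s.2])).
  by apply: triple_do => //=; rewrite /upd /= s2 s6 s25 !addn0.
move=> t [t13 t17 t12 tM] st; have ct := consts_off cs st isT.
pose I i (t' : state) := [/\ t'.1 13 = 3 + i, t'.1 17 = B + (i * n + i) * c &
  [/\ forall a, a < B -> t'.2 a = inp a, sound t'.2 &
      forall u, rk u < i -> t'.2 (cell u u (w u)) = 0]].
apply: (@triple_imp _ _ _ (I n)); last first.
  by move=> t' _ [_ _ [? ? H]]; split=> // u; apply/H/rk_lt.
apply: (@triple_loop _ _ _ n) => //.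
  rewrite /I t13 t17 tM !addn0; split=> //; split=> // u v d.
  by rewrite full m3_le_card.
move=> i t1 lt_i st1 [e13 e17 [inp1 snd1 dn1]].
have [[c1 c2 c4 _ c25] c5] := consts_off ct st1 isT.
have [u ru] := rkP lt_i; apply: triple_do => //.
have lt3 : 3 + i < B.
  by apply: leq_trans input_lt_base; rewrite -addnA ltn_add2l ltn_addr.
have addr : rk (w u) + (B + (i * n + i) * c) = cell u u (w u).
  by rewrite /slot ru addnCA [rk _ + _]addnC.
rewrite /I /tock /= /upd /= e13 e17 c1 c4 c5 c25 inp1 // -ru inp_colour ru addr.
split; first by rewrite addn1 addnS.
  have -> : i.+1 * n + i.+1 = i * n + i + n + 1 by rewrite mulSn; lia.
  by rewrite 2!(mulnDl (_ + _)) mul1n !addnA.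
split.
- move=> a aB; rewrite ifN ?inp1 // neq_ltn; apply/orP; left.
  by apply: leq_trans aB _; rewrite leq_addr.
- move=> u' v' d'; case: eqP => // /slot_inj[-> -> ->].
  by rewrite m3_refl.
move=> u'; rewrite ltnS leq_eqVlt => /orP[|lt_u]; last by rewrite dn1 // if_same.
by rewrite -ru => /eqP/rk_inj ->; rewrite eqxx.
Qed.

Lemma output_spec s : consts s -> s.1 30 = n * n ->
    (forall u v d, s.2 (cell u v d) = f u v d) ->
  triple s output_cmd (n * n * c * 23) (fun t =>
    forall u v, t.2 (rk u * n + rk v) = m2 e_conn w u v).
Proof.
move=> cs s30 full; have [[_ s2 _ s6 s25] _] := cs.
apply: (@triple_leq _ _ (3 + (n * n * (c * 14 + 5)).+1)).
  by apply: loop_cost; rewrite ?muln_gt0 ?n_gt0.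
apply: (triple_seq (Q1 := fun t => [/\ t.1 18 = 0, t.1 17 = B, t.1 9 = n * n & t.2 = s.2])).
  by apply: triple_do => //=; rewrite /upd /= s30 s6 s25 !addn0.
move=> t [t18 t17 t9 tM] st; have ct := consts_off cs st isT.
pose I i (t' : state) := [/\ t'.1 18 = i, t'.1 17 = B + i * c,
  forall u v d, t'.2 (cell u v d) = f u v d &
  forall u v, rk u * n + rk v < i -> t'.2 (rk u * n + rk v) = m2 e_conn w u v].
apply: (@triple_imp _ _ _ (I (n * n))); last first.
  by move=> t' _ [_ _ _ H] u v; apply/H/pair_lt_square.
apply: (@triple_loop _ _ _ (n * n)) => //.
  by rewrite /I t18 t17 tM addn0.
move=> i t1 lt_i st1 [e18 e17 full1 dn1].
have ct1 := consts_off ct st1 isT; have [[_ c2 c4 _ c25] _] := ct1.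
have [u ru] : exists u : V, rk u = i %/ n by apply: rkP; rewrite ltn_divLR.
have [v rv] : exists v : V, rk v = i %% n by apply: rkP; rewrite ltn_mod.
have Ei : i = rk u * n + rk v by rewrite ru rv -divn_eq.
apply: (@triple_leq _ _ (2 + ((c * (4 + 5)).+1 + 2))); first by lia.
apply: (triple_seq (Q1 := fun t' => [/\ t'.1 22 = n, t'.1 12 = c & t'.2 = t1.2])).
  by apply: triple_do => //=; rewrite /upd /= c2 c4 c25 !addn0.
move=> t2 [e22 e12 eM] st2; have ct2 := consts_off ct1 st2 isT.
(* The running minimum starts at |V|, which is at least the true minimum by [m3_le_card]. *)
pose J j (t' : state) := [/\ t'.1 17 = B + i * c + j, t'.2 = t1.2,
  m2 e_conn w u v <= t'.1 22 & forall d, rk d < j -> t'.1 22 <= f u v d].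
apply: (triple_seq (Q1 := J c)).
  apply: (@triple_loop _ _ _ c) => //.
    rewrite /J e22 eM addn0 st2 //; split=> //.
    by have [d ->] := m2_attained e_conn w u v; apply: m3_le_card.
  move=> j t3 lt_j st3 [a17 aM am2 ale]; have [d rd] := rkP lt_j.
  have [[d1 _ _ _ _] _] := consts_off ct2 st3 isT.
  have addr : B + i * c + j = cell u v d by rewrite /slot rd -Ei addnA.
  apply: triple_do => //=; rewrite /J /tock /= /upd /= d1 aM a17 addr full1.
  rewrite -minnE; split=> //.
  - by rewrite addn1 addnS addr.
  - by rewrite leq_min am2 m2_le.
  move=> d'; rewrite ltnS leq_eqVlt -rd => /orP[/eqP/rk_inj ->|]; first exact: geq_minr.
  by rewrite rd => /ale; apply/leq_trans/geq_minl.
move=> t3 [a17 aM am2 ale] st3; apply: triple_do => //.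
have a22 : t3.1 22 = m2 e_conn w u v.
  apply/eqP; rewrite eqn_leq am2 andbT.
  by have [d ->] := m2_attained e_conn w u v; apply/ale/rk_lt.
have a18 : t3.1 18 = i by rewrite st3 // st2.
have [[d1 _ _ _ _] _] := consts_off ct2 st3 isT.
rewrite /I /tock /= /upd /= d1 a18 a17 aM a22; split.
- by rewrite addn1.
- by rewrite -addnA -mulSnr.
(* The output overwrites only cells below [n * n], hence below [B], so the table survives. *)
- move=> u' v' d'; rewrite ifN ?full1 // neq_ltn; apply/orP; right.
  by apply: leq_trans lt_i (leq_trans output_lt_base _); rewrite leq_addr.
move=> u' v'; rewrite ltnS leq_eqVlt; case: eqP => [E _|_] /=; last exact: dn1.
by case: (divmod_inj (rk_lt v') (rk_lt v) (etrans E Ei)) => /rk_inj -> /rk_inj ->.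
Qed.

End Instance.

Definition main_cmd : cmd :=
  mul_cmd 5 4 2 ;; mul_cmd 6 2 2 ;;
  Do [:: IAdd 30 6 25; IAdd 6 6 2; IAdd 6 6 3; IAdd 6 6 3; IAdd 6 6 1;
         IAdd 6 6 1; IAdd 6 6 1] ;;
  fill_cmd ;; diagonal_cmd ;; rounds_cmd ;; output_cmd.

(* Register 29 is set to min(1, |E|), so that its loop runs the main part once
   if there is an edge. Otherwise |V| <= 1, the output is at most one zero, and
   the running time must not depend on |C|. *)
Definition linking_cmd : cmd :=
  Do [:: IConst 1 1; ILoad 2 25; ILoad 3 1; IAdd 26 1 1; ILoad 4 26;
         IStore 25 25; ISub 27 1 3; ISub 29 1 27] ;;
  Loop 29 main_cmd.

(** Since there is an edge, |V| and |C| are positive and the rounds dominate the cost of all other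
    phases. *)
Lemma main_spec (V C : finType) (e : rel V) (w : colouring V C)
    (es : seq (V * V)) (e_conn : connected_graph e) (s : state) :
    symmetric e ->
    (forall p, p \in es -> e p.1 p.2) ->
    (forall x y, e x y -> (x, y) \in es \/ (y, x) \in es) ->
    0 < size es ->
    (forall v, s.2 (3 + rk v) = rk (w v)) ->
    (forall q i, i < size es ->
       s.2 (3 + #|V| + i.*2) = rk (nth q es i).1 /\
       s.2 (3 + #|V| + i.*2).+1 = rk (nth q es i).2) ->
    s.1 1 = 1 -> s.1 2 = #|V| -> s.1 3 = size es -> s.1 4 = #|C| -> s.1 25 = 0 ->
  triple s main_cmd (#|V| ^ 3 * size es * #|C| ^ 2 * 403) (fun t =>
    forall u v, t.2 (rk u * #|V| + rk v) = m2 e_conn w u v).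
Proof.
set n := #|V|; set c := #|C|; set E := size es.
move=> e_sym es_e e_es es_gt0 inp_c inp_e s1 s2 s3 s4 s25.
(* The table starts beyond both the input, of length [3 + n + E.*2], and the output, of length
   [n * n]. *)
pose B := n * n + n + E + E + 1 + 1 + 1.
have [n_gt0 c_gt0] : 0 < n /\ 0 < c.
  have := es_gt0; rewrite /E; case: (es) => // -[x y] _ _.
  by split; apply/card_gt0P; [exists x|exists (w x)].
have inB : 3 + n + E.*2 <= B by rewrite /B -addnn; lia.
have outB : n * n <= B by rewrite /B; lia.
have -> : n ^ 3 * E * c ^ 2 = n * (E * (n * n * c * c)).
  by rewrite !expnS !expn0 !muln1; lia.
(* Bounding 1, [n] and [n * n * c] by the leading product gives 13 + 27 + 41 + 322 = 403. *)
apply: (@triple_leq _ _ ((3 + n * 6) + ((3 + n * 6) + (7 + (n * n * c * 18 +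
   (n * 15 + (n * (E * (n * n * c * c)) * 322 + n * n * c * 23))))))).
  have le1 : n <= n * (E * (n * n * c * c)).
    by rewrite leq_pmulr // !muln_gt0 n_gt0 c_gt0 es_gt0.
  have le2 : n * n * c <= n * (E * (n * n * c * c)).
    have le3 : n * c <= n * n * c * c.
      by rewrite -[n * n * c * c]mulnA mulnACA leq_pmulr // muln_gt0 n_gt0.
    rewrite -[X in X <= _]mulnA leq_mul2l (leq_trans le3) ?orbT //.
    exact: leq_pmull.
  by move: le1 le2; set z := n * (E * _); set z' := n * n * c; lia.
apply: (triple_seq (Q1 := fun t => t.1 5 = n * c /\ t.2 = s.2)).
  rewrite -[in X in 3 + X]s2; apply: triple_imp (mul_spec _ _ s25) _ => // t _ [-> ->].
  by rewrite s2 s4.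
move=> t [t5 tM] st.
have t25 : t.1 25 = 0 by rewrite st.
have t2 : t.1 2 = n by rewrite st.
apply: (triple_seq (Q1 := fun t' => t'.1 6 = n * n /\ t'.2 = s.2)).
  rewrite -[in X in 3 + X]t2; apply: triple_imp (mul_spec _ _ t25) _ => // t' _ [-> ->].
  by rewrite t2 tM.
move=> t1 [a6 aM] st1.
have a k : k \notin [:: 0; 5; 6; 12] -> t1.1 k = s.1 k.
  rewrite !inE !negb_or => /and4P[k0 k5 k6 k12]; rewrite st1 ?st //.
    by rewrite /= !inE !negb_or k0 k5 k12.
  by rewrite /= !inE !negb_or k0 k6 k12.
apply: (triple_seq (Q1 := fun t' => [/\ t'.1 6 = B, t'.1 30 = n * n & t'.2 = s.2])).
  by apply: triple_do => //=; rewrite /upd /= (a 1) //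
     (a 2) // (a 3) // (a 25) // s1 s2 s3 s25 a6 aM addn0.
move=> t3 [b6 b30 bM] st3.
have c3 : consts V C B t3.
  by split; [split; rewrite ?b6 // st3 // a|rewrite st3 // st1].
have b3 : t3.1 3 = E by rewrite st3 // a.
apply: (triple_seq (fill_spec w es_gt0 inB outB c3)).
move=> t4 [lo4 full4] st4; have c4 := consts_off c3 st4 isT.
have inp4 k : k < B -> t4.2 k = s.2 k by move=> kB; rewrite lo4 // bM.
apply: (triple_seq (diagonal_spec e_sym e_conn es_gt0 inp_c inB outB c4 inp4 full4)).
move=> t5' [inp5 snd5 dn5] st5; have c5 := consts_off c4 st5 isT.
have d3 : t5'.1 3 = E by rewrite st5 // st4.
apply: (triple_seq (rounds_spec e_sym es_e e_es es_gt0 inp_e inB outB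
  c5 d3 inp5 snd5 dn5)).
move=> t6 full6 st6; have c6 := consts_off c5 st6 isT.
have d30 : t6.1 30 = n * n by rewrite st6 // st5 // st4.
exact: (output_spec e_sym es_gt0 inB outB c6 d30 full6).
Qed.

(** * Edge listings, the encoding and the final theorem *)

Lemma eq_set2 (T : finType) (a b x y : T) : x != y ->
  [set a; b] = [set x; y] -> (a = x /\ b = y) \/ (a = y /\ b = x).
Proof.
move=> xy E; have := set21 a b; have := set22 a b; rewrite {1 2}E !inE.
have := set21 x y; have := set22 x y; rewrite -{1 2}E !inE.
do 4![case/orP=> /eqP ?]; subst; rewrite ?eqxx in xy *; by [left|right].
Qed.

(** Irreflexivity makes the ends of an edge distinct, so the set of its ends determines it up to
    orientation. *)
Lemma edge_listingP (V : finType) (e : rel V) es : simple_graph e ->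
    edge_listing e es ->
  [/\ size es = #|edges e|, forall p, p \in es -> e p.1 p.2 &
      forall x y, e x y -> (x, y) \in es \/ (y, x) \in es].
Proof.
case=> e_sym e_irr L; have mE := perm_mem L.
have neq x y : e x y -> x != y by apply: contraTneq => ->; rewrite e_irr.
split.
- by have := perm_size L; rewrite size_map -cardE.
- move=> [a b] pin; have := map_f (fun p => [set p.1; p.2]) pin.
  rewrite mE mem_enum => /imset2P[x y _]; rewrite inE => exy /(eq_set2 (neq _ _ exy)).
  by case=> -[-> ->] //; rewrite e_sym.
move=> x y exy; have : [set x; y] \in enum (edges e).
  by rewrite mem_enum; apply/imset2P; exists x y => //; rewrite inE.
rewrite -mE => /mapP[[a b] pin /esym/(eq_set2 (neq _ _ exy))].
by case=> -[Ea Eb]; rewrite /= in Ea Eb; rewrite -Ea -Eb; [left|right].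
Qed.

Lemma nth_allpairs (S T U : Type) (g : S -> T -> U) s t x y z i j :
    i < size s -> j < size t ->
  nth z [seq g a b | a <- s, b <- t] (i * size t + j) = g (nth x s i) (nth y t j).
Proof.
elim: s i => // a s IH [|i] lt_i lt_j; rewrite allpairs_cons nth_cat size_map.
  by rewrite lt_j (nth_map y).
rewrite mulSn -addnA ltnNge leq_addr /= addKn; exact: IH.
Qed.

Lemma encode_tableE (V : finType) (g : V -> V -> nat) u v :
  nth 0 (encode_table g) (rk u * #|V| + rk v) = g u v.
Proof.
rewrite /encode_table cardE (nth_allpairs _ u v) -?cardE ?rk_lt //.
by rewrite !nth_enum_rank.
Qed.

Lemma nth_flatten_pairs (T : Type) (g h : T -> nat) s q i : i < size s ->
  nth 0 (flatten [seq [:: g p; h p] | p <- s]) i.*2 = g (nth q s i) /\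
  nth 0 (flatten [seq [:: g p; h p] | p <- s]) i.*2.+1 = h (nth q s i).
Proof. by elim: s i => // p s IH [|i] //= /IH. Qed.

Section Encoding.
Variables (V C : finType) (es : seq (V * V)) (w : colouring V C).

Lemma encode_colour v : nth 0 (encode_instance es w) (3 + rk v) = rk (w v).
Proof.
rewrite /encode_instance nth_cat ltnNge leq_addr addKn nth_cat size_map -cardE.
rewrite rk_lt.
by rewrite (nth_map v) ?nth_enum_rank // -cardE rk_lt.
Qed.

Lemma encode_edge q i : i < size es ->
  nth 0 (encode_instance es w) (3 + #|V| + i.*2) = rk (nth q es i).1 /\
  nth 0 (encode_instance es w) (3 + #|V| + i.*2).+1 = rk (nth q es i).2.
Proof.
have tail j : nth 0 (encode_instance es w) (3 + #|V| + j)
    = nth 0 (flatten [seq [:: rk p.1; rk p.2] | p <- es]) j.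
  rewrite /encode_instance -addnA nth_cat ltnNge leq_addr addKn.
  by rewrite nth_cat size_map -cardE ltnNge leq_addr addKn.
move=> lt_i; rewrite -addnS !tail.
exact: (nth_flatten_pairs (fun p => rk p.1) (fun p => rk p.2)).
Qed.

End Encoding.

Theorem theorem4p8 :
  exists (P : program) (K : nat),
    forall (V C : finType) (e : rel V) (w : colouring V C) (es : seq (V * V)),
      simple_graph e ->
      forall e_conn : connected_graph e,
      edge_listing e es ->
      computes_within P (encode_instance es w) (encode_table (m2 e_conn w))
        (K * (#|V| ^ 3 * #|edges e| * #|C| ^ 2 + 1)).
Proof.
(* The total is at most [Z * 403 + 14], with [Z] the leading product; the summand 1 in the bound
   covers graphs without edges. *)
exists (compile 0 linking_cmd), 500 => V C e w es simple_e e_conn listing.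
have [sz es_e e_es] := edge_listingP simple_e listing.
have [e_sym e_irr] := simple_e; rewrite -sz.
set inp := encode_instance es w; set n := #|V|; set c := #|C|.
set s0 : state := (fun=> 0, nth 0 inp).
set Z := _ * _ * _.
suff [out le_t] : triple s0 linking_cmd (500 * (Z + 1)) (fun t =>
    forall u v, t.2 (rk u * n + rk v) = m2 e_conn w u v).
  apply: compile_computes => // i; rewrite size_allpairs -cardE -/n => lt_i.
  have n_gt0 : 0 < n by case: (n) lt_i.
  have [u ru] : exists u : V, rk u = i %/ n by apply: rkP; rewrite ltn_divLR.
  have [v rv] : exists v : V, rk v = i %% n by apply: rkP; rewrite ltn_mod.
  by rewrite (divn_eq i n) -ru -rv out encode_tableE.
pose b := if size es is 0 then 0 else 1.
apply: (@triple_leq _ _ (8 + (b * (Z * 403 + 5)).+1)).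
  by rewrite /b; case: (size es); lia.
apply: (triple_seq (Q1 := fun t => [/\ [/\ t.1 1 = 1, t.1 2 = n, t.1 3 = size es,
    t.1 4 = c & t.1 25 = 0], t.1 29 = b & t.2 = upd (nth 0 inp) 0 0])).
  apply: triple_do => //=; rewrite /upd /= /b; split=> //.
  by case: (size es) => [|k] /=; rewrite ?subn0 ?subnn // subSS sub0n subn0.
move=> t [[t1 t2 t3 t4 t25] t29 tM] st.
have [E0|es_gt0] := posnP (size es).
  have b0 : b = 0 by rewrite /b E0.
  rewrite b0 in t29 *; apply: (@triple_loop _ _ _ 0 _ (fun _ t' =>
    forall u v, t'.2 (rk u * n + rk v) = m2 e_conn w u v)) => // u v.
  (* Cell 0 was cleared once |V| had been loaded. A connected graph without edges has at most one
     vertex, so this zero is the only possible output entry. *)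
  rewrite tM.
  have all_eq x y : x = y :> V.
    case/connectP: (e_conn x y) => -[//|z p] /= /andP[/e_es].
    by rewrite (size0nil E0) => -[].
  rewrite (all_eq v u).
  have rk0 : rk u = 0.
    have n_le1 : #|V| <= 1 by apply/card_le1_eqP.
    by apply/eqP; rewrite -leqn0 -ltnS; apply: leq_trans (rk_lt u) n_le1.
  rewrite rk0 /=; apply/esym/eqP; rewrite -leqn0 -(m3_refl e_sym e_conn w u).
  exact: m2_le.
have b1 : b = 1 by rewrite /b; case: (size es) es_gt0.
rewrite b1 in t29 *.
(* The loop makes a single pass, so the invariant is the starting state before it and the result
   after it. *)
apply: (@triple_loop _ _ _ 1 _ (fun i t' => if i is 0 then t' = t else
  forall u v, t'.2 (rk u * n + rk v) = m2 e_conn w u v)) => //.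
case=> // t' _ _ ->; apply: main_spec => //; rewrite tM.
  exact: encode_colour.
exact: encode_edge.
Qed.
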